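(* Let $\mathbb{A}$ be a finite dimensional Kac algebra. If $\mathbb{A}$ is cyclic, then it is linearly primitive.
   Context: A finite dimensional Kac algebra is a finite dimensional Hopf ${\rm C}^{\star}$-algebra $(\mathbb{A},\Delta,\epsilon,S)$. A left coideal subalgebra of $\mathbb{A}$ is a unital $\star$-subalgebra $\mathbb{B}\subseteq\mathbb{A}$ with $\Delta(\mathbb{B})\subseteq\mathbb{A}\otimes\mathbb{B}$; these form a lattice $\mathcal{L}(\mathbb{A})$ under inclusion. A normal Kac subalgebra is a Kac subalgebra $\mathbb{B}$ (a unital $\star$-subalgebra with $\Delta(\mathbb{B})\subseteq\mathbb{B}\otimes\mathbb{B}$, $S(\mathbb{B})=\mathbb{B}$) stable under the adjoint actions: $\sum x_{(1)}bS(x_{(2)})\in\mathbb{B}$ and $\sum S(x_{(1)})bx_{(2)}\in\mathbb{B}$ for all $x\in\mathbb{A}$, $b\in\mathbb{B}$, where $\Delta(x)=\sum x_{(1)}\otimes x_{(2)}$. $\mathbb{A}$ is cyclic if all its left coideal subalgebras are normal Kac subalgebras and the lattice $\mathcal{L}(\mathbb{A})$ is distributive. $\mathbb{A}$ is linearly primitive if there is an irreducible complex representation $V$ of $\mathbb{A}$ such that for every irreducible complex representation $W$ there is $n>0$ with $W\le V^{\otimes n}$ (i.e. $W$ is equivalent to a subrepresentation), where $\mathbb{A}$ acts on tensor products through $\Delta$. *)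

(* Defs.v *)
From HB Require Import structures.
From mathcomp Require Import all_boot all_order all_algebra all_field.
From mathcomp Require Import complex.
From mathcomp Require Import boolp reals.

Set Implicit Arguments.
Unset Strict Implicit.
Unset Printing Implicit Defensive.

Import Order.TTheory GRing.Theory Num.Theory.
Local Open Scope ring_scope.
Local Open Scope complex_scope.

(* Tensor products of finite dimensional vector spaces. An element of the
   tensor product of U and V is the matrix of its coordinates in the basis
   e_i (x) e_j, where e is the basis [vbasis fullv]. [tlift f] is the linear
   map on the tensor product induced by a bilinear [f] (lemma [tlift_tens]). *)

Section Tensor.
Variable K : fieldType.
Implicit Types U V W : vectType K.

Definition tensor U V : vectType K := 'M[K]_(\dim {:U}, \dim {:V}).

Definition tens U V (u : U) (v : V) : tensor U V :=
  \matrix_(i, j) (coord (vbasis {:U}) i u * coord (vbasis {:V}) j v).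

Definition tlift_fun U V W (f : U -> V -> W) (t : tensor U V) : W :=
  \sum_i \sum_j (t : 'M_(_, _)) i j *: f (vbasis {:U})`_i (vbasis {:V})`_j.

Fact tlift_fun_is_linear U V W (f : U -> V -> W) : linear (tlift_fun f).
Proof.
move=> a s t; rewrite /tlift_fun scaler_sumr -big_split; apply: eq_bigr => i _.
rewrite scaler_sumr -big_split; apply: eq_bigr => j _ /=.
by rewrite !mxE scalerDl scalerA.
Qed.

HB.instance Definition _ U V W (f : U -> V -> W) :=
  GRing.isLinear.Build K (tensor U V) W _ (tlift_fun f)
    (tlift_fun_is_linear f).

Definition tlift U V W (f : U -> V -> W) : 'Hom(tensor U V, W) :=
  linfun (tlift_fun f).

Definition bilin U V W (f : U -> V -> W) : Prop :=
  (forall v, linear (f^~ v)) /\ (forall u, linear (f u)).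

Lemma lin_hom U W (g : U -> W) : linear g -> exists h : 'Hom(U, W), h =1 g.
Proof.
move=> lg.
pose G : {linear U -> W} := HB.pack g (GRing.isLinear.Build K U W _ g lg).
by exists (linfun G) => u; rewrite lfunE.
Qed.

Lemma lin_vbasis U W (g : U -> W) : linear g ->
  forall u, g u = \sum_i coord (vbasis {:U}) i u *: g (vbasis {:U})`_i.
Proof.
move=> /lin_hom[h hE] u; rewrite -hE {1}(coord_vbasis (memvf u)) linear_sum.
by apply: eq_bigr => i _; rewrite linearZ /= hE.
Qed.

Lemma tlift_tens U V W (f : U -> V -> W) : bilin f ->
  forall u v, tlift f (tens u v) = f u v.
Proof.
case=> fl fr u v; rewrite lfunE /= /tlift_fun (lin_vbasis (fl v)).
apply: eq_bigr => i _; rewrite (lin_vbasis (fr _)) scaler_sumr.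
by apply: eq_bigr => j _; rewrite scalerA mxE.
Qed.

Lemma tens_bilin U V : bilin (@tens U V).
Proof.
by split=> [v a u1 u2 | u a v1 v2]; apply/matrixP => i j;
  rewrite !mxE linearP /= ?mulrDl -?mulrA // mulrDr mulrCA.
Qed.

Lemma tens_sum U V (t : tensor U V) :
  t = \sum_i \sum_j
        (t : 'M_(_, _)) i j *: tens (vbasis {:U})`_i (vbasis {:V})`_j.
Proof.
rewrite {1}[t]matrix_sum_delta; apply: eq_bigr => i _; apply: eq_bigr => j _.
congr (_ *: _); apply/matrixP => k l; rewrite !mxE.
rewrite !coord_free ?(basis_free (vbasisP _)) //.
by rewrite -natrM mulnb (eq_sym i) (eq_sym j).
Qed.

Definition tmap U V U' V' (f : 'Hom(U, U')) (g : 'Hom(V, V')) :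
  'Hom(tensor U V, tensor U' V') := tlift (fun u v => tens (f u) (g v)).

Definition tassoc U V W :
  'Hom(tensor U (tensor V W), tensor (tensor U V) W) :=
  tlift (fun u => tlift (fun v w => tens (tens u v) w)).

Definition tens_vs U V (X : {vspace U}) (Y : {vspace V}) :
  {vspace tensor U V} :=
  <<[seq tens x y | x <- vbasis X, y <- vbasis Y]>>%VS.

End Tensor.

Notation "x \ox y" := (tens x y) (at level 40, left associativity).

Lemma mem_tens_vs (K : fieldType) (U V : vectType K) (X : {vspace U})
    (Y : {vspace V}) x y : x \in X -> y \in Y -> x \ox y \in tens_vs X Y.
Proof.
move=> Xx Yy; have [tl tr] := tens_bilin U V.
have [h hE] := lin_hom (tl y); rewrite -hE (coord_vbasis Xx) linear_sum.
apply: memv_suml => i _; rewrite linearZ memvZ //= hE.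
have [g gE] := lin_hom (tr (vbasis X)`_i).
rewrite -gE (coord_vbasis Yy) linear_sum.
apply: memv_suml => j _; rewrite linearZ memvZ //= gE; apply: memv_span.
by apply: allpairs_f; rewrite mem_nth ?size_tuple.
Qed.

Lemma tens_vs_ind (K : fieldType) (U V W : vectType K) (X : {vspace U})
    (Y : {vspace V}) (f : 'Hom(tensor U V, W)) (Z : {vspace W}) :
    (forall x y, x \in X -> y \in Y -> f (x \ox y) \in Z) ->
  forall t, t \in tens_vs X Y -> f t \in Z.
Proof.
move=> fXY t; rewrite memv_preim => /(subvP _ _) -> //.
apply/span_subvP => _ /allpairsP[[x y] [/= Xx Yy ->]].
by rewrite -memv_preim fXY // vbasis_mem.
Qed.

Lemma mem_tens_vsr (K : fieldType) (U V : vectType K) (Y : {vspace V})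
    (t : tensor U V) :
  reflect (forall i, tlift (fun u v => coord (vbasis {:U}) i u *: v) t \in Y)
          (t \in tens_vs {:U} Y).
Proof.
have bl i : bilin (fun (u : U) (v : V) => coord (vbasis {:U}) i u *: v).
  split=> [v k u1 u2 | u k v1 v2]; first by rewrite linearP scalerDl scalerA.
  by rewrite scalerDr !scalerA mulrC.
apply: (iffP idP) => [Yt i | Yt].
  apply: tens_vs_ind Yt => x y _ Yy.
  by rewrite (tlift_tens (bl i)) memvZ.
rewrite (tens_sum t); apply: memv_suml => i _.
rewrite (_ : \sum_j _ = (vbasis {:U})`_i \ox
    tlift (fun u v => coord (vbasis {:U}) i u *: v) t).
  by rewrite mem_tens_vs ?memvf.
rewrite lfunE /= /tlift_fun (bigD1 i) //= [X in _ + X]big1 => [|k ki];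
  last first.
  apply: big1 => j _; rewrite coord_free ?(basis_free (vbasisP _)) //.
  by rewrite (negbTE ki) scale0r scaler0.
have [g gE] := lin_hom ((tens_bilin U V).2 (vbasis {:U})`_i).
rewrite addr0 -gE linear_sum; apply: eq_bigr => j _.
by rewrite coord_free ?(basis_free (vbasisP _)) // eqxx scale1r linearZ /= gE.
Qed.

Lemma tens_hom_ext (K : fieldType) (U V W : vectType K)
    (f g : 'Hom(tensor U V, W)) :
  (forall u v, f (u \ox v) = g (u \ox v)) -> f = g.
Proof.
move=> fg; apply/lfunP => t; rewrite (tens_sum t) !linear_sum.
apply: eq_bigr => i _; rewrite !linear_sum; apply: eq_bigr => j _.
by rewrite !linearZ /= fg.
Qed.

Lemma tens_bilin_ext (K : fieldType) (U V U' V' W : vectType K)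
    (f g : tensor U V -> tensor U' V' -> W) : bilin f -> bilin g ->
    (forall u v u' v', f (u \ox v) (u' \ox v') = g (u \ox v) (u' \ox v')) ->
  forall s t, f s t = g s t.
Proof.
move=> [fl fr] [gl gr] fg s t.
have [f1 f1E] := lin_hom (fl t); have [g1 g1E] := lin_hom (gl t).
rewrite -f1E -g1E; suff -> : f1 = g1 by []; apply: tens_hom_ext => u v.
rewrite f1E g1E.
have [f2 f2E] := lin_hom (fr (u \ox v)).
have [g2 g2E] := lin_hom (gr (u \ox v)).
rewrite -f2E -g2E; suff -> : f2 = g2 by []; apply: tens_hom_ext => u' v'.
by rewrite f2E g2E fg.
Qed.

Section TensorMap.
Variables (K : fieldType) (U V U' V' : vectType K).

Lemma tmap_tens (f : 'Hom(U, U')) (g : 'Hom(V, V')) u v :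
  tmap f g (u \ox v) = f u \ox g v.
Proof.
have [tl tr] := tens_bilin U' V'.
by apply: tlift_tens; split=> [x k u1 u2 | x k v1 v2]; rewrite linearP ?tl ?tr.
Qed.

Lemma tmap_bilin : bilin (@tmap K U V U' V').
Proof.
have [tl tr] := tens_bilin U' V'.
split=> [g k f1 f2 | f k g1 g2]; apply: tens_hom_ext => u v;
  by rewrite add_lfunE scale_lfunE !tmap_tens add_lfunE scale_lfunE ?tl ?tr.
Qed.

End TensorMap.

(* The product and the involution of the tensor square of an algebra:
   (a (x) b) (c (x) d) = ac (x) bd and (a (x) b)^* = a^* (x) b^*. *)

Definition tmul (K : fieldType) (A : falgType K) (s t : tensor A A) :
    tensor A A :=
  tlift (fun a b => tlift (fun c d => (a * c) \ox (b * d)) t) s.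

Definition tstar (R : realType) (A : falgType R[i]) (star : A -> A)
    (t : tensor A A) : tensor A A :=
  \sum_i \sum_j ((t : 'M_(_, _)) i j)^* *:
    (star (vbasis {:A})`_i \ox star (vbasis {:A})`_j).

Lemma tmul_tens (K : fieldType) (A : falgType K) (a b c d : A) :
  tmul (a \ox b) (c \ox d) = (a * c) \ox (b * d).
Proof.
have [tl tr] := tens_bilin A A.
have inner x y : bilin (fun c d : A => (x * c) \ox (y * d)).
  by split=> [v k u1 u2 | u k v1 v2]; rewrite mulrDr -scalerAr ?tl ?tr.
rewrite /tmul tlift_tens; first by rewrite tlift_tens.
split=> [v k u1 u2 | u k v1 v2]; rewrite !lfunE /= /tlift_fun scaler_sumr;
  rewrite -big_split; apply: eq_bigr => i _; rewrite scaler_sumr -big_split;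
  apply: eq_bigr => j _; rewrite /= mulrDl -scalerAl ?tl ?tr scalerDr;
  by rewrite !scalerA mulrC.
Qed.

Lemma tmul_bilin (K : fieldType) (A : falgType K) : bilin (@tmul K A).
Proof.
split=> [t k u1 u2 | s k v1 v2]; first by rewrite /tmul linearP.
rewrite /tmul !lfunE /= /tlift_fun scaler_sumr -big_split.
apply: eq_bigr => i _; rewrite scaler_sumr -big_split; apply: eq_bigr => j _.
by rewrite linearP /= scalerDr !scalerA mulrC.
Qed.

Lemma mem_tmul (K : fieldType) (A : falgType K) (Y : {vspace A}) s t :
    {in Y &, forall x y, x * y \in Y} ->
  s \in tens_vs {:A} Y -> t \in tens_vs {:A} Y ->
  tmul s t \in tens_vs {:A} Y.
Proof.
move=> YM Ys Yt; have [tl tr] := tmul_bilin A.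
have [h hE] := lin_hom (tl t); rewrite -hE.
apply: tens_vs_ind Ys => a b _ Yb; rewrite hE.
have [g gE] := lin_hom (tr (a \ox b)); rewrite -gE.
apply: tens_vs_ind Yt => c d _ Yd.
by rewrite gE tmul_tens mem_tens_vs ?memvf ?YM.
Qed.

Lemma tstar_tens (R : realType) (A : falgType R[i]) (star : A -> A) :
    (forall (k : R[i]) x y, star (k *: x + y) = k^* *: star x + star y) ->
  forall a b, tstar star (a \ox b) = star a \ox star b.
Proof.
move=> sP a b; have [tl tr] := tens_bilin A A.
have s0 : star 0 = 0.
  by have := sP (-1) 0 0; rewrite scaler0 addr0 rmorphN1 scaleN1r addNr.
have sE x : star x =
    \sum_i (coord (vbasis {:A}) i x)^* *: star (vbasis {:A})`_i.
  rewrite {1}(coord_vbasis (memvf x)).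
  elim/big_rec2: _ => [|i y z _ <-]; [exact: s0 | exact: sP].
have [h hE] := lin_hom (tl (star b)).
rewrite -hE (sE a) linear_sum; apply: eq_bigr => i _.
have [g gE] := lin_hom (tr (star (vbasis {:A})`_i)).
rewrite linearZ /= hE -gE (sE b) linear_sum scaler_sumr.
by apply: eq_bigr => j _; rewrite linearZ /= gE scalerA mxE rmorphM.
Qed.

(* [tlift f (Delta x)] is the Sweedler sum of the f x_(1) x_(2).
   Completeness of the norm is automatic, the algebra being finite
   dimensional. The star-preservation of the counit, S (S (x^* )^* ) = x and
   S^2 = id are consequences of the axioms below. *)

Record kacAlgebra (R : realType) := KacAlgebra {
  kac_sort :> falgType R[i];
  star : kac_sort -> kac_sort;
  cnorm : kac_sort -> R;
  Delta : 'Hom(kac_sort, tensor kac_sort kac_sort);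
  counit : 'Hom(kac_sort, R[i]^o);
  antipode : 'End(kac_sort);
  starP : forall (a : R[i]) (x y : kac_sort),
    star (a *: x + y) = a^* *: star x + star y;
  starK : involutive star;
  starM : forall x y, star (x * y) = star y * star x;
  cnorm_eq0 : forall x, cnorm x = 0 -> x = 0;
  cnormD : forall x y, cnorm (x + y) <= cnorm x + cnorm y;
  cnormZ : forall (a : R[i]) x, (cnorm (a *: x))%:C = `|a| * (cnorm x)%:C;
  cnormM : forall x y, cnorm (x * y) <= cnorm x * cnorm y;
  cnorm_star : forall x, cnorm (star x * x) = cnorm x ^+ 2;
  Delta1 : Delta 1 = 1 \ox 1;
  DeltaM : forall x y, Delta (x * y) = tmul (Delta x) (Delta y);
  Delta_star : forall x, Delta (star x) = tstar star (Delta x);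
  Delta_coassoc : forall x,
    tassoc _ _ _ (tmap \1%VF Delta (Delta x)) = tmap Delta \1%VF (Delta x);
  counit1 : counit 1 = 1;
  counitM : forall x y, counit (x * y) = counit x * counit y;
  counitl : forall x, tlift (fun a b => counit a *: b) (Delta x) = x;
  counitr : forall x, tlift (fun a b => counit b *: a) (Delta x) = x;
  antipodel : forall x,
    tlift (fun a b => antipode a * b) (Delta x) = (counit x : R[i])%:A;
  antipoder : forall x,
    tlift (fun a b => a * antipode b) (Delta x) = (counit x : R[i])%:A
}.

Lemma star1 (R : realType) (A : kacAlgebra R) : star 1 = 1 :> A.
Proof. by have := starM (star 1 : A) 1; rewrite !mulr1 !starK mulr1. Qed.

Section KacTheory.
Variables (R : realType) (A : kacAlgebra R).
Implicit Types B : {vspace A}.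

Definition star_subalgebra B : Prop :=
  [/\ 1 \in B, {in B &, forall x y, x * y \in B}
    & {in B, forall x, star x \in B}].

Definition left_coideal_subalgebra B : Prop :=
  star_subalgebra B /\ {in B, forall b, Delta A b \in tens_vs fullv B}.

Definition kac_subalgebra B : Prop :=
  [/\ star_subalgebra B, {in B, forall b, Delta A b \in tens_vs B B}
    & (antipode A @: B)%VS = B].

Definition normal_kac_subalgebra B : Prop :=
  [/\ kac_subalgebra B,
      forall x b, b \in B ->
        tlift (fun x1 x2 => x1 * b * antipode A x2) (Delta A x) \in B
    & forall x b, b \in B ->
        tlift (fun x1 x2 => antipode A x1 * b * x2) (Delta A x) \in B].

(* The lattice of left coideal subalgebras, ordered by inclusion: the meet is
   the intersection, the join is the subalgebra generated by the sum. *)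

Definition lcoideal : Type :=
  {B : {vspace A} | `[< left_coideal_subalgebra B >]}.

HB.instance Definition _ := [isSub of lcoideal for sval].
HB.instance Definition _ := [Choice of lcoideal by <:].

Lemma lcoidealP (X : lcoideal) : left_coideal_subalgebra (val X).
Proof. exact/asboolP/(valP X). Qed.

Definition lcoideal_le (X Y : lcoideal) := (val X <= val Y)%VS.

Fact lcoideal_le_refl : reflexive lcoideal_le.
Proof. by move=> X; apply: subvv. Qed.
Fact lcoideal_le_anti : antisymmetric lcoideal_le.
Proof. by move=> X Y; rewrite -eqEsubv => /eqP/val_inj. Qed.
Fact lcoideal_le_trans : transitive lcoideal_le.
Proof. by move=> Y X Z; apply: subv_trans. Qed.

Fact lcoideal_display : Order.disp_t. Proof. exact: Order.Disp tt tt. Qed.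
HB.instance Definition _ := Order.Le_isPOrder.Build lcoideal_display lcoideal
  lcoideal_le_refl lcoideal_le_anti lcoideal_le_trans.

Fact lcoideal_meet_subproof (X Y : lcoideal) :
  `[< left_coideal_subalgebra (val X :&: val Y) >].
Proof.
apply/asboolP.
have [[X1 XM Xs] XD] := lcoidealP X; have [[Y1 YM Ys] YD] := lcoidealP Y.
split; first split.
- by rewrite memv_cap X1.
- move=> x y; rewrite !memv_cap => /andP[Xx Yx] /andP[Xy Yy].
  by rewrite XM ?YM.
- by move=> x; rewrite !memv_cap => /andP[Xx Yx]; rewrite Xs ?Ys.
move=> b; rewrite memv_cap => /andP[/XD DX /YD DY].
apply/mem_tens_vsr => i; rewrite memv_cap.
by rewrite (elimT (mem_tens_vsr _ _) DX) (elimT (mem_tens_vsr _ _) DY).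
Qed.

Fact lcoideal_join_subproof (X Y : lcoideal) :
  `[< left_coideal_subalgebra (agenv (val X + val Y)) >].
Proof.
apply/asboolP.
have [[X1 XM Xs] XD] := lcoidealP X; have [[Y1 YM Ys] YD] := lcoidealP Y.
set J := agenv _.
have sXYJ : (val X + val Y <= J)%VS by apply: sub_agenv.
have J1 : 1 \in J by rewrite memvE sub1_agenv.
have JM : {in J &, forall x y, x * y \in J}.
  by move=> x y Jx Jy; rewrite -[J]agenvM memv_mul.
have starD x y : star (x + y) = star x + star y :> A.
  by rewrite -[x in LHS]scale1r starP rmorph1 scale1r.
have star0 : star 0 = 0 :> A.
  by apply: (addrI (star (0 : A))); rewrite -starD !addr0.
have starZ a x : star (a *: x) = a^* *: star x :> A.
  by rewrite -[a *: x]addr0 starP star0 addr0.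
have star_sum n (F : 'I_n -> A) : star (\sum_i F i) = \sum_i star (F i).
  by apply: (big_morph _ starD star0).
(* the subspace of the x such that x^* belongs to J *)
pose J' := <<[seq star x | x <- vbasis J]>>%VS.
have memJ' x : (x \in J') = (star x \in J).
  apply/idP/idP => [|Jx].
    rewrite -[J']/(span (in_tuple _)) => /coord_span ->.
    rewrite star_sum memv_suml // => i _; rewrite starZ memvZ //.
    have : (in_tuple [seq star x | x <- vbasis J])`_i
       \in [seq star x | x <- vbasis J] by rewrite mem_nth.
    by case/mapP=> y Jy ->; rewrite starK vbasis_mem.
  rewrite -[x]starK (coord_vbasis Jx) star_sum memv_suml // => i _.
  by rewrite starZ memvZ // memv_span // map_f // mem_nth ?size_tuple.
split; first split=> //.
  move=> x Jx; rewrite -memJ'; apply: subvP x Jx; apply: agenv_sub_modl.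
    by rewrite -memvE memJ' star1.
  apply/prodvP => u v /memv_addP[x Xx [y Yy ->]]; rewrite !memJ' => Jv.
  by rewrite starM JM // (subvP sXYJ) // starD memv_add ?Xs ?Ys.
move=> b Jb; rewrite memv_preim; apply: subvP b Jb; apply: agenv_sub_modl.
  by rewrite -memvE -memv_preim Delta1 mem_tens_vs ?memvf.
apply/prodvP => u v /memv_addP[x Xx [y Yy ->]]; rewrite -!memv_preim => Jv.
have sub_tens (Z : {vspace A}) t : (Z <= val X + val Y)%VS ->
    t \in tens_vs {:A} Z -> t \in tens_vs {:A} J.
  move=> sZ /mem_tens_vsr Zt; apply/mem_tens_vsr => i.
  exact: subvP (subv_trans sZ sXYJ) _ (Zt i).
rewrite DeltaM mem_tmul // linearD memvD //.
  exact: sub_tens (addvSl _ _) (XD x Xx).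
exact: sub_tens (addvSr _ _) (YD y Yy).
Qed.

Definition lcoideal_meet (X Y : lcoideal) : lcoideal :=
  Sub (val X :&: val Y)%VS (lcoideal_meet_subproof X Y).

Definition lcoideal_join (X Y : lcoideal) : lcoideal :=
  Sub (agenv (val X + val Y)) (lcoideal_join_subproof X Y).

Fact lcoideal_meetP (X Y Z : lcoideal) :
  (X <= lcoideal_meet Y Z)%O = ((X <= Y)%O && (X <= Z)%O).
Proof. exact: subv_cap. Qed.

Fact lcoideal_joinP (X Y Z : lcoideal) :
  (lcoideal_join X Y <= Z)%O = ((X <= Z)%O && (Y <= Z)%O).
Proof.
rewrite -[RHS]subv_add; apply/idP/idP => [|sXYZ].
  exact: subv_trans (sub_agenv _).
have [[Z1 ZM _] _] := lcoidealP Z.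
apply: agenv_sub_modl; first by rewrite -memvE.
by apply/prodvP => u v /(subvP sXYZ) Zu Zv; apply: ZM.
Qed.

HB.instance Definition _ :=
  Order.POrder_MeetJoin_isLattice.Build lcoideal_display lcoideal
    lcoideal_meetP lcoideal_joinP.

Definition cyclic_kac : Prop :=
  (forall B, left_coideal_subalgebra B -> normal_kac_subalgebra B) /\
  (forall X Y Z : lcoideal, X `&` (Y `|` Z) = (X `&` Y) `|` (X `&` Z))%O.

Record kac_repr := KacRepr {
  repr_space : vectType R[i];
  repr_act : {linear A -> 'End(repr_space)};
  repr_act1 : repr_act 1 = \1%VF;
  repr_actM : forall x y, repr_act (x * y) = (repr_act x \o repr_act y)%VF
}.

Definition irreducible_repr (V : kac_repr) : Prop :=
  (fullv : {vspace repr_space V}) <> 0%VS /\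
  forall U : {vspace repr_space V},
    (forall x, (repr_act V x @: U <= U)%VS) -> U = 0%VS \/ U = fullv.

(* An injective intertwiner f makes W equivalent to the subrepresentation
   limg f of V. *)
Definition subrepr (W V : kac_repr) : Prop :=
  exists2 f : 'Hom(repr_space W, repr_space V), lker f = 0%VS &
    forall x, (f \o repr_act W x)%VF = (repr_act V x \o f)%VF.

Section TensorRepr.
Variables V W : kac_repr.

Definition tensor_act_fun (t : tensor A A) :
    'End(tensor (repr_space V) (repr_space W)) :=
  tlift (fun a b => tmap (repr_act V a) (repr_act W b)) t.

Lemma tensor_act_tens a b :
  tensor_act_fun (a \ox b) = tmap (repr_act V a) (repr_act W b).
Proof.
have [tl tr] := tmap_bilin (repr_space V) (repr_space W)
  (repr_space V) (repr_space W).
by apply: tlift_tens; split=> [x k u1 u2 | x k v1 v2];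
  rewrite linearP ?tl ?tr.
Qed.

Lemma tensor_actM s t :
  tensor_act_fun (tmul s t) = (tensor_act_fun s \o tensor_act_fun t)%VF.
Proof.
have [tl tr] := tmul_bilin A; pose F := tensor_act_fun.
apply: (tens_bilin_ext (f := fun s t => F (tmul s t))
  (g := fun s t => (F s \o F t)%VF)) => [||a b c d].
- split=> [u k v1 v2 | u k v1 v2]; rewrite /F /tensor_act_fun.
    by rewrite [tmul _ _]tl linearP.
  by rewrite [tmul _ _]tr linearP.
- split=> [u k v1 v2 | u k v1 v2]; rewrite /F /tensor_act_fun linearP.
    by rewrite comp_lfunDl comp_lfunZl.
  by rewrite comp_lfunDr comp_lfunZr.
rewrite /F tmul_tens !tensor_act_tens; apply: tens_hom_ext => u v.
by rewrite comp_lfunE !tmap_tens !repr_actM !comp_lfunE.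
Qed.

Definition tensor_repr_act (x : A) := tensor_act_fun (Delta A x).

Fact tensor_repr_act_is_linear : linear tensor_repr_act.
Proof. by move=> k x y; rewrite /tensor_repr_act /tensor_act_fun !linearP. Qed.

HB.instance Definition _ := GRing.isLinear.Build R[i] A
  'End(tensor (repr_space V) (repr_space W)) _ tensor_repr_act
  tensor_repr_act_is_linear.

Fact tensor_repr_act1 : tensor_repr_act 1 = \1%VF.
Proof.
rewrite /tensor_repr_act Delta1 tensor_act_tens !repr_act1.
by apply: tens_hom_ext => u v; rewrite tmap_tens !lfunE.
Qed.

Fact tensor_repr_actM x y :
  tensor_repr_act (x * y) = (tensor_repr_act x \o tensor_repr_act y)%VF.
Proof. by rewrite /tensor_repr_act DeltaM tensor_actM. Qed.

Definition tensor_repr : kac_repr := KacRepr tensor_repr_act1 tensor_repr_actM.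

End TensorRepr.

(* Meaningful for n > 0 only: n = 0 gives V again. *)
Definition tensor_pow (V : kac_repr) (n : nat) : kac_repr :=
  iter n.-1 (fun U => tensor_repr U V) V.

Definition linearly_primitive : Prop :=
  exists2 V : kac_repr, irreducible_repr V &
    forall W : kac_repr, irreducible_repr W ->
      exists2 n : nat, (0 < n)%N & subrepr W (tensor_pow V n).

End KacTheory.

(* Main.v *)
From HB Require Import structures.
Require Import Defs.
From mathcomp Require Import all_boot all_order all_algebra all_field.
From mathcomp Require Import complex boolp reals.

(** The model is a finite group whose subgroup lattice is distributive: the
    product of the elements [1 - p_H], where [H] runs over the minimal
    subgroups and [p_H] is the average of [H], is nonzero in the group algebra,
    and an irreducible representation in which it does not vanish is faithful.

    Cyclicity is used to produce an element of this kind. In a Kac algebra each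
    left coideal subalgebra [L] has an integral [p], with [l p = eps(l) p] and
    [eps(p) = 1] ([exists_integral]), and a representation trivial on [L] sends
    [1 - p] to zero. The key fact ([integral_absorbed_sub]) is that, for Kac
    subalgebras [K] and [L], a nonzero [z] of [K] with [p z = z] forces [L]
    into [K]; hence [(1 - p) z] is nonzero when [L] is not contained in [K].
    Distributivity controls the left coideal subalgebras of the join of [K] and
    [L], and adding one [L] after the other gives a nonzero [z] that vanishes
    in all representations trivial on some left coideal subalgebra other than
    the scalars ([cyclic_separating]). By semisimplicity [z] does not vanish in
    some irreducible [V] ([exists_irreducible]).

    It remains to see that the tensor powers of such a [V] contain all
    irreducible representations. Their common annihilator [I] is a two-sided
    ideal and a bi-ideal. Let [p] be the central projection complementary to
    [I]. A finiteness argument gives [Delta(p) (1 (x) p) = p (x) p]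
    ([ideal_projection_grouplike]), which says that [p] itself belongs to the
    left coideal subalgebra of the [a] with [Delta(a) (1 (x) p) = a (x) p].
    This subalgebra acts trivially on [V], hence consists of scalars, so that
    [p = 1] and [I = 0] ([separated_faithful]). An irreducible representation
    is isomorphic to a left ideal generated by an idempotent, and a tensor
    power of [V] in which this idempotent does not vanish contains it
    ([faithful_embedding]).

    Semisimplicity enters through a single statement, that left ideals have
    right identities ([left_ideal_right_identity]); the C*-norm serves only to
    prove it. *)

Set Implicit Arguments.
Unset Strict Implicit.
Unset Printing Implicit Defensive.

Import Order.TTheory GRing.Theory Num.Theory.
Local Open Scope ring_scope.
Local Open Scope complex_scope.

(** * Linear algebra and tensor products *)

Section LinearAlgebra.
Variables (K : fieldType) (V : vectType K).
Implicit Types (U : {vspace V}) (P : V -> Prop).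

Lemma vspace_of_pred P :
    P 0 -> (forall k u v, P u -> P v -> P (k *: u + v)) ->
  exists U, forall x, x \in U <-> P x.
Proof.
move=> P0 PD.
suff Hn n U : (forall x, x \in U -> P x) ->
    (\dim {:V} - \dim U < n)%N ->
    exists U, forall x, x \in U <-> P x.
  by apply: (Hn _ 0%VS _ (ltnSn _)) => x; rewrite memv0 => /eqP->.
elim: n U => // n IHn U UP; rewrite ltnS => leU.
have [[x Px nUx]|noP] := pselect (exists2 x, P x & x \notin U); last first.
  exists U => x; split=> [/UP//|Px]; apply: contrapT => /negP nUx.
  by apply: noP; exists x.
apply: (IHn (<[x]> + U)%VS) => [y /memv_addP[_ /vlineP[k ->] [u Uu ->]]|].
  exact: PD (UP u Uu).
have ltUx : (\dim U < \dim (<[x]> + U))%N.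
  rewrite ltn_neqAle dimvS ?addvSr // andbT; apply: contra nUx => /eqP dU.
  have sUx : (U <= <[x]> + U)%VS by apply: addvSr.
  have : (<[x]> + U <= U)%VS by rewrite -(geq_leqif (dimv_leqif_sup sUx)) dU.
  by move=> /subvP; apply; rewrite (subvP (addvSl _ _)) ?memv_line.
apply: leq_trans leU; apply: ltn_sub2l => //.
by apply: leq_trans ltUx _; rewrite dimvS ?subvf.
Qed.

Lemma min_dimv_ex (P : {vspace V} -> Prop) B : P B ->
  exists2 M, P M & forall N, P N -> (\dim M <= \dim N)%N.
Proof.
have [n] := ubnP (\dim B); elim: n B => // n IHn B; rewrite ltnS => leB PB.
have [[N PN ltN]|noN] := pselect (exists2 N, P N & (\dim N < \dim B)%N).
  exact: IHn (leq_trans ltN leB) PN.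
by exists B => // N PN; rewrite leqNgt; apply/negP => ltN; apply: noN; exists N.
Qed.

Lemma exists_dual (v : V) : v != 0 ->
  exists f : 'Hom(V, K^o), f v = 1.
Proof.
move=> v0; have [i vi] : exists i, coord (vbasis {:V}) i v != 0.
  apply/existsP; apply: contra_neqT v0; rewrite negb_exists => /forallP v0.
  rewrite (coord_vbasis (memvf v)) big1 // => i _.
  by move/negPn/eqP: (v0 i) => ->; rewrite scale0r.
have [|f fE] := @lin_hom K V K^o
  (fun w => (coord (vbasis {:V}) i v)^-1 * coord (vbasis {:V}) i w).
  by move=> k u w; rewrite linearP mulrDr /= mulrCA.
by exists f; rewrite fE mulVf.
Qed.

End LinearAlgebra.

Section TensorLift.
Variables (K : fieldType) (U V : vectType K).
Implicit Types (W : vectType K) (s t : tensor U V).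

Lemma tensPl k (u u' : U) (v : V) :
  (k *: u + u') \ox v = k *: (u \ox v) + u' \ox v.
Proof. exact: (tens_bilin U V).1. Qed.

Lemma tensPr k (u : U) (v v' : V) :
  u \ox (k *: v + v') = k *: (u \ox v) + u \ox v'.
Proof. exact: (tens_bilin U V).2. Qed.

Lemma tensZl k (u : U) (v : V) : (k *: u) \ox v = k *: (u \ox v).
Proof. by apply/matrixP => i j; rewrite !mxE linearZ mulrA. Qed.

Lemma tensZr k (u : U) (v : V) : u \ox (k *: v) = k *: (u \ox v).
Proof. by apply/matrixP => i j; rewrite !mxE linearZ mulrCA. Qed.

Lemma tlift_comp W W' (g : 'Hom(W, W')) (F : U -> V -> W) t :
  g (tlift F t) = tlift (fun a b => g (F a b)) t.
Proof.
rewrite !lfunE /= /tlift_fun linear_sum; apply: eq_bigr => i _.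
by rewrite linear_sum; apply: eq_bigr => j _; rewrite linearZ.
Qed.

Lemma eq_tlift W (F G : U -> V -> W) t :
  (forall a b, F a b = G a b) -> tlift F t = tlift G t.
Proof. by move=> FG; congr (tlift _ t); apply/funext => a; apply/funext. Qed.

Lemma linear_tlift W W' (g : W -> W') (F : U -> V -> W) t : linear g ->
  g (tlift F t) = tlift (fun a b => g (F a b)) t.
Proof.
by move=> /lin_hom[h hE]; rewrite -hE tlift_comp; apply: eq_tlift => a b.
Qed.

Lemma tliftP W k (F G : U -> V -> W) t :
  tlift (fun a b => k *: F a b + G a b) t = k *: tlift F t + tlift G t.
Proof.
rewrite !lfunE /= /tlift_fun scaler_sumr -big_split; apply: eq_bigr => i _.
rewrite scaler_sumr -big_split; apply: eq_bigr => j _ /=.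
by rewrite scalerDr !scalerA mulrC.
Qed.

Lemma tliftZ W k (F : U -> V -> W) t :
  tlift (fun a b => k *: F a b) t = k *: tlift F t.
Proof.
rewrite !lfunE /= /tlift_fun scaler_sumr; apply: eq_bigr => i _.
by rewrite scaler_sumr; apply: eq_bigr => j _; rewrite !scalerA mulrC.
Qed.

Lemma tlift_sum W I (r : seq I) (F : I -> U -> V -> W) t :
  tlift (fun a b => \sum_(i <- r) F i a b) t = \sum_(i <- r) tlift (F i) t.
Proof.
elim: r => [|i r IHr].
  rewrite big_nil; under eq_tlift do rewrite big_nil -(scale0r 0).
  by rewrite tliftZ scale0r.
rewrite big_cons -IHr -[tlift (F i) t]scale1r -tliftP; apply: eq_tlift => a b.
by rewrite big_cons scale1r.
Qed.

Lemma tlift_tensE t : tlift (fun u v => u \ox v) t = t.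
Proof. by rewrite lfunE /= /tlift_fun -tens_sum. Qed.

Lemma tens_comp_ext W W' (f : 'Hom(tensor U V, W)) (g : 'Hom(W, W'))
    (h : 'Hom(tensor U V, W')) :
  (forall u v, g (f (u \ox v)) = h (u \ox v)) -> forall t, g (f t) = h t.
Proof.
move=> fgh t; rewrite -comp_lfunE; congr (fun_of_lfun _ t).
by apply: tens_hom_ext => u v; rewrite comp_lfunE fgh.
Qed.

Lemma tens_vs_sub (X X' : {vspace U}) (Y Y' : {vspace V}) t :
    (X <= X')%VS -> (Y <= Y')%VS ->
  t \in tens_vs X Y -> t \in tens_vs X' Y'.
Proof.
move=> sX sY; rewrite -[t in _ -> t \in _]id_lfunE.
apply: tens_vs_ind => x y Xx Yy.
by rewrite id_lfunE mem_tens_vs ?(subvP sX) ?(subvP sY).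
Qed.

Lemma tens_vsT t : t \in tens_vs {:U} {:V}.
Proof.
rewrite [t]tens_sum; apply: memv_suml => i _; apply: memv_suml => j _.
by rewrite memvZ // mem_tens_vs ?memvf.
Qed.

Lemma tlift_ext W (F G : U -> V -> W) (X : {vspace U}) (Y : {vspace V}) t :
    bilin F -> bilin G -> t \in tens_vs X Y ->
    (forall x y, x \in X -> y \in Y -> F x y = G x y) ->
  tlift F t = tlift G t.
Proof.
move=> bF bG XYt FG; apply/eqP; rewrite -subr_eq0 -memv0.
rewrite -[_ - _]/(_ + (- _)) -opp_lfunE -add_lfunE.
apply: tens_vs_ind XYt => x y Xx Yy.
by rewrite add_lfunE opp_lfunE !tlift_tens // FG // subrr mem0v.
Qed.

Lemma slices_eq0 t :
  (forall d : 'Hom(U, K^o), tlift (fun u v => (d u : K) *: v) t = 0) -> t = 0.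
Proof.
move=> t0; have : t \in tens_vs fullv 0%VS.
  apply/mem_tens_vsr => i; rewrite memv0; apply/eqP.
  have [|d dE] := @lin_hom K U K^o (coord (vbasis {:U}) i).
    exact: linearP.
  by rewrite -[RHS](t0 d); apply: eq_tlift => a b; rewrite dE.
move=> /(@tens_vs_ind _ _ _ _ _ _ \1%VF 0%VS); rewrite id_lfunE memv0 => t00.
apply/eqP/t00 => x y _; rewrite memv0 => /eqP->; rewrite id_lfunE memv0.
by apply/eqP/matrixP => i j; rewrite !mxE linear0 mulr0.
Qed.

End TensorLift.

(** * Ideals in an algebra with a proper involution *)

Section ProperInvolution.
Variables (R : realType) (A : kacAlgebra R).
Implicit Types (B N : {vspace A}) (x y h : A).

(** This consequence of the C*-identity excludes nilpotent one-sided ideals; the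
    norm enters the proof through it alone. *)
Lemma star_mul_eq0 x : star x * x = 0 -> x = 0.
Proof.
move=> xx0; apply: cnorm_eq0; apply/eqP; rewrite -sqrf_eq0 -cnorm_star xx0.
have /eqP := cnormZ (0 : R[i]) (0 : A).
by rewrite scaler0 normr0 mul0r (inj_eq (@complexI R)).
Qed.

Lemma star_linear_sub x y : star (x - y) = star x - star y.
Proof. by rewrite addrC -scaleN1r starP rmorphN1 scaleN1r addrC. Qed.

Lemma starZ (k : R[i]) x : star (k *: x) = k^* *: star x.
Proof.
by rewrite -[k *: x]addr0 starP -[0]subr0 star_linear_sub !subrr addr0.
Qed.

(** A nonzero self-adjoint [h] is not nilpotent. The subspaces [h^k B h^k] with
    [k] a power of two decrease, so one of them equals the next, and then [h^2k]
    lies in [h^2k B h^2k]: left multiples of [h] contain an eigenvector, of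
    eigenvalue 1, of the right multiplication by some [s * h]. *)
Lemma selfadjoint_regular B h : star_subalgebra B ->
    h \in B -> star h = h -> h != 0 ->
  exists c s, [/\ c \in B, s \in B, c * h != 0 & c * h = c * h * s * h].
Proof.
move=> [B1 BM _]; pose D x := ((amull x \o amulr x) @: B)%VS.
have [n] := ubnP (\dim (D h)); elim: n h => // n IHn h; rewrite ltnS => leDn.
move=> Bh hs h0.
have hh0 : h * h != 0.
  by apply: contra_neq h0 => hh; apply: star_mul_eq0; rewrite hs.
have sD : (D (h * h)%R <= D h)%VS.
  apply/subvP => _ /memv_imgP[b Bb ->]; apply/memv_imgP.
  exists (h * b * h); first by rewrite !BM.
  by rewrite !lfunE /= !lfunE /= !mulrA.
have [eqD | neD] := eqVneq (D (h * h)%R) (D h).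
  have : h * h \in D h.
    apply/memv_imgP; exists 1 => //.
    by rewrite !lfunE /= !lfunE /= mul1r.
  rewrite -eqD => /memv_imgP[b Bb]; rewrite !lfunE /= !lfunE /= => hE.
  exists h, (b * h); split=> //; first exact: BM.
  by rewrite {1}hE !mulrA.
have [||||c [s [Bc Bs ch0 chE]]] := IHn (h * h) => //.
- apply: leq_trans leDn; rewrite ltn_neqAle dimvS // andbT.
  by apply: contra neD => /eqP dD; rewrite eqEdim sD dD leqnn.
- exact: BM.
- by rewrite starM hs.
exists (c * h), (s * h); split; rewrite ?BM -?mulrA //.
by move: chE; rewrite -!mulrA.
Qed.

(** Semisimplicity, in the form in which it is used below: left ideals are
    generated by idempotents. Among the [u] in [1 + N], take one for which
    [N * u] has the least dimension. If [N * u] had a nonzero element [w], then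
    [h = star w * w] would be a nonzero self-adjoint element of it, and for the
    [s] of the previous lemma the element [u * (1 - s * h)] would do better. So
    [N * u] is zero, and [1 - u] is a right identity of [N]. *)
Lemma left_ideal_right_identity B N : star_subalgebra B -> (N <= B)%VS ->
    (forall b x, b \in B -> x \in N -> b * x \in N) ->
  exists2 e, e \in N & forall x, x \in N -> x * e = x.
Proof.
move=> sB sNB Nl; have [B1 BM Bs] := sB; have NB := subvP sNB.
suff Hu n u : 1 - u \in N -> (\dim (amulr u @: N) < n)%N ->
    exists2 e, e \in N & forall x, x \in N -> x * e = x.
  by apply: (Hu _ 1); [rewrite subrr mem0v | apply: ltnSn].
elim: n u => // n IHn u Nu; rewrite ltnS => dimN.
have Bu : u \in B by rewrite -[u](subKr 1) rpredB // NB.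
have NM x : x \in N -> x * u \in N.
  by move=> Nx; rewrite -[u](subKr 1) mulrBr mulr1 rpredB // Nl // NB.
have [Nu0 | ] := eqVneq (amulr u @: N)%VS 0%VS.
  exists (1 - u) => // x Nx; rewrite mulrBr mulr1.
  have : x * u \in (amulr u @: N)%VS.
    by apply/memv_imgP; exists x => //; rewrite lfunE.
  by rewrite Nu0 memv0 => /eqP->; rewrite subr0.
rewrite -vpick0; set w := vpick _ => w0.
have /memv_imgP[m Nm] : w \in (amulr u @: N)%VS by apply: memv_pick.
rewrite lfunE /= => wE.
have Bw : w \in B by rewrite wE NB ?NM.
have [||||c [s [Bc Bs' ch0 chE]]] := @selfadjoint_regular B (star w * w) => //.
- by rewrite BM ?Bs.
- by rewrite starM starK.
- by apply: contra_neq w0 => /star_mul_eq0.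
set h := star w * w in ch0 chE.
have hNu : c * h \in (amulr u @: N)%VS.
  apply/memv_imgP; exists (c * (star w * m)); first by rewrite !Nl ?Bs.
  by rewrite lfunE /= /h wE !mulrA.
have Nh : h \in N by rewrite /h wE Nl ?NM // -wE Bs.
clearbody h.
(* right multiplication by [1 - s * h] kills [c * h], which lies in [N * u] *)
apply: (IHn (u * (1 - s * h))).
  rewrite mulrBr mulr1 opprD opprK addrA memvD //.
  exact: Nl (Nl _ _ _ _).
apply: leq_trans dimN.
have -> : (amulr (u * (1 - s * h)) @: N =
           amulr (1 - s * h) @: (amulr u @: N))%VS.
  rewrite -limg_comp; congr (_ @: _)%VS; apply/lfunP => x.
  by rewrite !lfunE /= !lfunE /= mulrA.
set f := amulr _.
rewrite -(limg_ker_dim f (amulr u @: N)%VS) -[X in (X < _)%N]add0n.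
rewrite ltn_add2r lt0n dimv_eq0; apply: contra_neq ch0 => ker0.
apply/eqP; rewrite -memv0 -ker0 memv_cap hNu memv_ker lfunE /=.
by rewrite mulrBr mulr1 !mulrA -chE subrr.
Qed.

Lemma star_subalgebraT : star_subalgebra ({:A} : {vspace A}).
Proof. by split=> [|x y _ _|x _]; rewrite memvf. Qed.

(** A two-sided ideal [I] is complemented by a central self-adjoint idempotent:
    the right identity of [I] is self-adjoint, since [I] is stable under the
    involution, and it commutes with all elements, since it is an identity of
    [I] on both sides. *)
Lemma ideal_projection (I : {vspace A}) :
    (forall a x, x \in I -> a * x \in I) ->
    (forall a x, x \in I -> x * a \in I) ->
  exists p : A,
  [/\ 1 - p \in I, forall x, x \in I -> x * p = 0, star p = p &
      forall a, a * p = p * a].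
Proof.
move=> Il Ir.
have [e Ie eid] := left_ideal_right_identity star_subalgebraT (subvf I)
  (fun b x _ => @Il b x).
have Is x : x \in I -> star x \in I.
  move=> Ix; suff w0 : star x * (1 - e) = 0.
    rewrite -[star x](subrK (star x * e)) -[X in X - _]mulr1 -mulrBr w0.
    by rewrite add0r Il.
  apply: star_mul_eq0; rewrite starM starK -mulrA [x * _]mulrA mulrBr mulr1.
  by rewrite eid ?subrr ?mulr0 // Ir.
have eidl x : x \in I -> star e * x = x.
  by move=> Ix; rewrite -{1}[x]starK -starM eid ?starK // Is.
have es : star e = e by rewrite -[LHS]eid ?Is // eidl.
rewrite es in eidl.
have ec a : a * e = e * a.
  by rewrite -[LHS]eidl ?Il // mulrA [in LHS]eid ?Ir.
exists (1 - e); split=> [|x Ix||a].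
- by rewrite subKr.
- by rewrite mulrBr mulr1 eid ?subrr.
- by rewrite star_linear_sub star1 es.
- by rewrite mulrBr mulrBl mulr1 mul1r ec.
Qed.

End ProperInvolution.

(** * Sweedler sums *)

Section Sweedler.
Variables (R : realType) (A : kacAlgebra R).
Implicit Types (W : vectType R[i]) (x y z : A).
Local Notation "\eps x" := (counit A x : R[i]) (at level 10, x at level 8).

Definition sweedler W (F : A -> A -> W) x : W := tlift F (Delta A x).

Lemma sweedlerP W (F : A -> A -> W) : linear (sweedler F).
Proof. by move=> k x y; rewrite /sweedler !linearP. Qed.

Lemma sweedlerZ W (F : A -> A -> W) k x :
  sweedler F (k *: x) = k *: sweedler F x.
Proof. by rewrite /sweedler !linearZ. Qed.

Definition trilin W (F : A -> A -> A -> W) :=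
  [/\ forall b c, linear (fun a => F a b c),
      forall a c, linear (fun b => F a b c)
    & forall a b, linear (F a b)].

Lemma sweedlerA W (F : A -> A -> A -> W) x : trilin F ->
  sweedler (fun a b => sweedler (fun c d => F a c d) b) x =
  sweedler (fun a b => sweedler (fun c d => F c d b) a) x.
Proof.
move=> [F1 F2 F3]; pose G : 'Hom(tensor (tensor A A) A, W) :=
  tlift (fun (t : tensor A A) c => tlift (fun a b => F a b c) t).
have Gt t c : G (t \ox c) = tlift (fun a b => F a b c) t.
  apply: tlift_tens; split=> [{}c k u v | {}t k u v]; first by rewrite linearP.
  by rewrite -tliftP; apply: eq_tlift => a b; rewrite F3.
have assocE (a : A) (s : tensor A A) :
  tassoc _ _ _ (a \ox s) = tlift (fun v w => (a \ox v) \ox w) s.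
  apply: tlift_tens; split=> [{}s k u v | u k v w]; last by rewrite linearP.
  by rewrite -tliftP; apply: eq_tlift => c d /=; rewrite tensPl tensPl.
transitivity (G (tassoc _ _ _ (tmap \1%VF (Delta A) (Delta A x)))); last first.
  rewrite Delta_coassoc /tmap tlift_comp; apply: eq_tlift => a b.
  by rewrite Gt id_lfunE.
rewrite /tmap !tlift_comp; apply: eq_tlift => a b.
rewrite id_lfunE assocE tlift_comp; apply: eq_tlift => c d.
by rewrite Gt tlift_tens //; split.
Qed.

Lemma sweedlerM W (F : A -> A -> W) x y : bilin F ->
  sweedler F (x * y) =
  sweedler (fun a b => sweedler (fun c d => F (a * c) (b * d)) y) x.
Proof.
move=> bF; rewrite /sweedler DeltaM /tmul tlift_comp; apply: eq_tlift => a b.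
rewrite tlift_comp; apply: eq_tlift => c d; exact: tlift_tens.
Qed.

Lemma tmul_sweedler (f g : A -> A -> tensor A A) x y :
  tmul (sweedler f x) (sweedler g y) =
  sweedler (fun a b => sweedler (fun c d => tmul (f a b) (g c d)) y) x.
Proof.
have [tl tr] := tmul_bilin A.
have [h hE] := lin_hom (tl (sweedler g y)); rewrite -hE tlift_comp.
apply: eq_tlift => a b; rewrite hE; have [k kE] := lin_hom (tr (f a b)).
by rewrite -kE tlift_comp; apply: eq_tlift => c d; rewrite kE.
Qed.

Lemma dualP (f : 'Hom(A, R[i]^o)) k x y :
  f (k *: x + y) = k * (f x : R[i]) + (f y : R[i]).
Proof. by rewrite linearP. Qed.

Lemma counitP k x y : \eps (k *: x + y) = k * \eps x + \eps y.
Proof. by rewrite linearP. Qed.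

End Sweedler.

(** * Integrals and inclusions of Kac subalgebras *)

Section Integrals.
Variables (R : realType) (A : kacAlgebra R).
Implicit Types (B N K L : {vspace A}) (x y z l : A) (W : vectType R[i]).
Local Notation "\eps x" := (counit A x : R[i]) (at level 10, x at level 8).
Local Notation S := (antipode A).

(** The kernel of the counit on [B] is a left ideal of [B]; if [e] is its right
    identity, then it annihilates [p = 1 - e] from the left. *)
Lemma exists_integral B : star_subalgebra B ->
  exists p,
    [/\ p \in B, \eps p = 1 & forall b, b \in B -> b * p = \eps b *: p].
Proof.
move=> sB; have [B1 BM Bs] := sB.
have memN x : (x \in B :&: lker (counit A))%VS = (x \in B) && (\eps x == 0).
  by rewrite memv_cap memv_ker.
have [||e Ne eid] :=
  @left_ideal_right_identity R A B (B :&: lker (counit A)) sB.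
- exact: capvSl.
- move=> b x Bb; rewrite !memN => /andP[Bx /eqP x0].
  by rewrite BM //= counitM x0 mulr0.
move: Ne; rewrite memN => /andP[Be /eqP e0].
exists (1 - e); split; first by rewrite rpredB.
  by rewrite linearB /= counit1 e0 subr0.
move=> b Bb; have Nb : b - \eps b *: 1 \in (B :&: lker (counit A))%VS.
  rewrite memN memvB ?memvZ //= linearB linearZ /= counit1.
  by rewrite [_ *: _]mulr1 subrr.
have := eid _ Nb; rewrite mulrBl -scalerAl mul1r mulrBr mulr1 scalerBr => bE.
by rewrite -[X in X - _](subrK (\eps b *: 1)) -bE addrC addrA addKr addrC.
Qed.

(** When [L] acts on [z] through the counit,
    [z_(1) (x) l z_(2) = S(l) z_(1) (x) z_(2)]: both sides are equal to
    [S(l_(1)) l_(2) z_(1) (x) l_(3) z_(2)]. *)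
Lemma sweedler_integral_shift L z l W (F : A -> A -> W) :
    (forall y, y \in L -> y * z = \eps y *: z) ->
    Delta A l \in tens_vs {:A} L -> bilin F ->
  sweedler (fun a b => F a (l * b)) z = sweedler (fun a b => F (S l * a) b) z.
Proof.
move=> Lz Ll [Fl Fr].
have [|H HE] := @lin_hom _ A W
  (fun y => sweedler (fun a b => F (S y * a) b) z).
  move=> k u v; rewrite -tliftP; apply: eq_tlift => a b.
  by rewrite linearP mulrDl -scalerAl Fl.
have [|P PE] := @lin_hom _ A W
  (fun d => sweedler (fun a b => F a (d * b)) z).
  move=> k u v; rewrite -tliftP; apply: eq_tlift => a b.
  by rewrite mulrDl -scalerAl Fr.
rewrite -[LHS]PE -[RHS]HE -[in RHS](counitr l) tlift_comp.
transitivity (sweedler (fun l1 l2 =>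
    sweedler (fun a b => F (S l1 * a) b) (l2 * z)) l); last first.
  apply: (tlift_ext _ _ Ll) => [||l1 l2 _ Ll2].
  - split=> [b k u v | a k u v]; last by rewrite mulrDl -scalerAl sweedlerP.
    rewrite -tliftP; apply: eq_tlift => c d.
    by rewrite linearP mulrDl -scalerAl Fl.
  - split=> [b k u v | a k u v].
      by rewrite scalerDr scalerA mulrC -scalerA linearP.
    by rewrite counitP scalerDl -scalerA linearP.
  by rewrite (Lz _ Ll2) sweedlerZ -HE linearZ.
transitivity (sweedler (fun u d => sweedler (fun l1 c =>
   sweedler (fun a b => F (S l1 * (c * a)) (d * b)) z) u) l); last first.
  rewrite -sweedlerA; last split.
  - apply: eq_tlift => l1 l2; rewrite sweedlerM //.
    by split=> [b k u v | a k u v]; rewrite ?Fr // mulrDr -scalerAr Fl.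
  - move=> b c k u v; rewrite -tliftP; apply: eq_tlift => a' b'.
    by rewrite linearP mulrDl -scalerAl Fl.
  - move=> b c k u v; rewrite -tliftP; apply: eq_tlift => a' b'.
    by rewrite mulrDl -scalerAl mulrDr -scalerAr Fl.
  - move=> b c k u v; rewrite -tliftP; apply: eq_tlift => a' b'.
    by rewrite mulrDl -scalerAl Fr.
rewrite -[in LHS](counitl l) tlift_comp; apply: eq_tlift => u d.
rewrite linearZ /= PE.
have [|Q QE] := @lin_hom _ A W
  (fun y => sweedler (fun a b => F (y * a) (d * b)) z).
  move=> k v w; rewrite -tliftP; apply: eq_tlift => a b.
  by rewrite mulrDl -scalerAl Fl.
transitivity (Q (tlift (fun l1 c => S l1 * c) (Delta A u))).
  rewrite antipodel linearZ /= QE; congr (_ *: _).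
  by apply: eq_tlift => a b; rewrite mul1r.
rewrite tlift_comp; apply: eq_tlift => l1 c; rewrite QE.
by apply: eq_tlift => a b; rewrite mulrA.
Qed.

(** In a group algebra this says that a nonzero element supported in a subgroup
    [K] and invariant under the translations by [L] forces [L] into [K]. In
    general, fix a functional [phi] with [phi z = 1]; then
    [S l = S(l) z_(1) S(z_(2)) phi(z_(3))]. By the previous lemma
    [S(l) z_(1) (x) z_(2)] is [z_(1) (x) l z_(2)], so its first leg lies in [K]
    and is not changed by a projection onto [K]; the rest of the product lies
    in [K] as well. Hence [K] contains [S(L) = L]. *)
Lemma integral_absorbed_sub K L z :
    kac_subalgebra K -> kac_subalgebra L -> z \in K -> z != 0 ->
    (forall y, y \in L -> y * z = \eps y *: z) ->
  (L <= K)%VS.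
Proof.
move=> [[K1 KM Ks] KD KS] [_ LD LS] Kz z0 Lz.
rewrite -LS; apply/subvP => _ /memv_imgP[l Ll ->].
have DL : Delta A l \in tens_vs {:A} L.
  by apply: tens_vs_sub (LD l Ll); rewrite ?subvf ?subvv.
have [phi phiz] := exists_dual z0.
pose G (a b : A) : A := sweedler (fun c d => (phi d : R[i]) *: (a * S c)) b.
have bG : bilin G.
  split=> [b k u v | a k u v]; last exact: sweedlerP.
  rewrite -tliftP; apply: eq_tlift => c d.
  by rewrite mulrDl -scalerAl scalerDr !scalerA mulrC.
(* [G a b] is [a S(b_(1)) phi(b_(2))] *)
have Gz : sweedler (fun a b => G a b) z = 1.
  rewrite sweedlerA; last first.
    split=> [b c k u v | b c k u v | b c k u v].
    - by rewrite mulrDl -scalerAl scalerDr !scalerA mulrC.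
    - by rewrite linearP mulrDr -scalerAr scalerDr !scalerA mulrC.
    - by rewrite dualP scalerDl -scalerA.
  transitivity (sweedler (fun a b =>
      (phi b : R[i]) *: ((\eps a : R[i]) *: (1 : A))) z).
    apply: eq_tlift => a b; rewrite /sweedler tliftZ; congr (_ *: _).
    exact: antipoder.
  have [|h hE] := @lin_hom _ A A (fun x => (phi x : R[i]) *: 1).
    by move=> k u v; rewrite dualP scalerDl scalerA.
  rewrite -[RHS]scale1r -[in RHS]phiz -hE -[in RHS](counitl z) tlift_comp.
  by apply: eq_tlift => a b; rewrite [RHS]linearZ /= hE !scalerA mulrC.
have -> : S l = sweedler (fun a b => G (projv K (S l * a)) b) z.
  have gE (a b : A) : tlift G (a \ox b) = G a b by apply: tlift_tens.
  have bP : bilin (fun a b : A => projv K a \ox b).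
    by split=> [b k u v | a k u v]; rewrite ?tensPr // linearP tensPl.
  have shift : sweedler (fun a b : A => (S l * a) \ox b) z =
     sweedler (fun a b : A => (projv K (S l * a)) \ox b) z.
    rewrite -(sweedler_integral_shift Lz DL (tens_bilin A A)).
    rewrite -(sweedler_integral_shift Lz DL bP).
    apply: (tlift_ext _ _ (KD z Kz)) => [||a b Ka _]; last by rewrite projv_id.
    - split=> [b k u v | a k u v]; rewrite ?tensPl //.
      by rewrite mulrDr -scalerAr tensPr.
    - split=> [b k u v | a k u v]; rewrite ?mulrDr -?scalerAr ?tensPr //.
      by rewrite linearP tensPl.
  transitivity (tlift G (sweedler (fun a b : A => (S l * a) \ox b) z)).
  2: by rewrite shift tlift_comp; apply: eq_tlift => a b; rewrite gE.
  rewrite tlift_comp -[LHS]mulr1 -Gz.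
  have [|h hE] := @lin_hom _ A A (fun x => S l * x).
    by move=> k u v; rewrite mulrDr scalerAr.
  rewrite -hE tlift_comp; apply: eq_tlift => a b; rewrite hE gE.
  rewrite -hE tlift_comp; apply: eq_tlift => c d; rewrite hE.
  by rewrite -scalerAr mulrA.
apply: tens_vs_ind (KD z Kz) => a b Ka Kb; rewrite tlift_tens; last first.
  split=> [b' k u v | a' k u v]; last exact: sweedlerP.
  by rewrite mulrDr -scalerAr linearP bG.1.
apply: tens_vs_ind (KD b Kb) => c d Kc Kd; rewrite tlift_tens; last first.
  split=> [d' k u v | c' k u v]; last by rewrite dualP scalerDl -scalerA.
  by rewrite linearP mulrDr -scalerAr scalerDr !scalerA mulrC.
by rewrite memvZ // KM ?memv_proj // -KS memv_img.
Qed.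

End Integrals.

(** * An element detecting all left coideal subalgebras *)

Section Separation.
Variables (R : realType) (A : kacAlgebra R).
Implicit Types (B M N : {vspace A}) (K L : lcoideal A) (x y z : A).
Implicit Type V : kac_repr A.
Local Notation "\eps x" := (counit A x : R[i]) (at level 10, x at level 8).

Definition acts_trivially B V :=
  forall b, b \in B -> repr_act V b = \eps b *: \1%VF.

(** A representation in which a separating [z] is nonzero is trivial on no left
    coideal subalgebra of [B] but the scalars. *)
Definition separates B z := forall L, (val L <= B)%VS ->
  ~~ (val L <= <[1]>)%VS ->
  forall V, acts_trivially (val L) V -> repr_act V z = 0.

Lemma lcoideal1 : left_coideal_subalgebra (<[1]> : {vspace A}).
Proof.
split; first split.
- exact: memv_line.
- move=> _ _ /vlineP[k ->] /vlineP[k' ->].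
  by rewrite -scalerAl mul1r !memvZ ?memv_line.
- by move=> _ /vlineP[k ->]; rewrite starZ star1 memvZ ?memv_line.
move=> _ /vlineP[k ->]; rewrite linearZ /= Delta1 memvZ //.
by rewrite mem_tens_vs ?memvf ?memv_line.
Qed.

Lemma lcoidealT : left_coideal_subalgebra ({:A}).
Proof. by split=> [|b _]; [apply: star_subalgebraT | apply: tens_vsT]. Qed.

(** The pair ([K], [z]), with [z] in [K] separating for [K], starts at the
    scalars and grows. Let [L] have the least dimension among the left coideal
    subalgebras not contained in [K], and let [p] be an integral of [L]. Then
    [(1 - p) * z] belongs to the join of [K] and [L]. It is nonzero, for
    otherwise [L] would act on [z] through the counit, hence lie in [K]. It is
    separating: take [B] in the join. If [B] contains [L], then [1 - p] acts as
    zero where [B] acts trivially; if not, the meet of [B] and [L] lies in [K]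
    by minimality, so that by distributivity [B] lies in [K]. *)
Lemma cyclic_separating : cyclic_kac A -> exists2 z, z != 0 & separates {:A} z.
Proof.
move=> [normA distA].
have kacL L : kac_subalgebra (val L) by have [] := normA _ (lcoidealP L).
suff grow n K z : (\dim {:A} - \dim (val K) < n)%N -> z \in val K -> z != 0 ->
    separates (val K) z -> exists2 z, z != 0 & separates {:A} z.
  pose K1 : lcoideal A := Sub <[1]>%VS (asboolT lcoideal1).
  apply: (grow _ K1 1 (ltnSn _)) => [||L sL]; rewrite ?oner_neq0 ?memv_line //.
  by rewrite sL.
elim: n K z => // n IHn K z; rewrite ltnS => leK Kz z0 Kzsep.
have [KT|nKT] := boolP ({:A} <= val K)%VS.
  exists z => // L _ nL; apply: Kzsep => //; apply: subv_trans KT; exact: subvf.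
pose P M := left_coideal_subalgebra M /\ ~~ (M <= val K)%VS.
have [L0 [lcL nLK] minL] := min_dimv_ex (conj lcoidealT nKT : P {:A}%VS).
pose L : lcoideal A := Sub L0 (asboolT lcL).
have [p [Lp p1 pL]] : exists p, [/\ p \in val L, \eps p = 1 &
    forall b, b \in val L -> b * p = \eps b *: p].
  by apply: exists_integral; have [] := lcL.
pose J := (K `|` L)%O.
have sKJ : (val K <= val J)%VS by apply: (leUl K L).
have sLJ : (val L <= val J)%VS by apply: (leUr L K).
have [[J1 JM _] _] := lcoidealP J.
apply: (IHn J ((1 - p) * z)).
- apply: leq_trans leK; apply: ltn_sub2l.
    rewrite ltn_neqAle dimvS ?subvf // andbT; apply: contra nKT => /eqP dK.
    by rewrite -dimv_leqif_sup ?subvf // dK.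
  rewrite ltn_neqAle dimvS // andbT; apply: contra nLK => /eqP dJ.
  apply: subv_trans sLJ _; rewrite -(geq_leqif (dimv_leqif_sup sKJ)).
  by rewrite dJ.
- by rewrite JM ?memvB // ?(subvP sLJ p) ?(subvP sKJ z).
- apply: contraNneq nLK => /eqP; rewrite mulrBl mul1r subr_eq0 => /eqP zE.
  apply: (integral_absorbed_sub (kacL K) (kacL L) Kz z0) => y Ly.
  by rewrite {1}zE mulrA pL // -scalerAl -zE.
move=> B sBJ nB V trV; have [sLB|nLB] := boolP (val L <= val B)%VS.
  rewrite repr_actM linearB /= repr_act1 (trV p) ?(subvP sLB) // p1 scale1r.
  by rewrite subrr comp_lfun0l.
suff sBK : (val B <= val K)%VS.
  by rewrite repr_actM (Kzsep B) ?comp_lfun0r.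
have BE : B = ((B `&` K) `|` (B `&` L))%O by rewrite -distA; apply/esym/meet_l.
have sBLK : (val (B `&` L)%O <= val K)%VS.
  apply: contraNT nLB => nBLK.
  have := minL (val (B `&` L)%O) (conj (lcoidealP _) nBLK).
  rewrite (geq_leqif (dimv_leqif_sup (capvSr (val B) (val L)))) => sL.
  exact: subv_trans sL (capvSl _ _).
have : (B <= K)%O by rewrite BE leUx leIr.
by [].
Qed.

Lemma left_ideal_repr M : (forall a m, m \in M -> a * m \in M) ->
  exists V, exists2 f : 'Hom(repr_space V, A), lker f = 0%VS /\ limg f = M &
    forall a v, f (repr_act V a v) = a * f v.
Proof.
move=> Ml.
pose g (a : A) (u : subvs_of M) : subvs_of M := vsproj M (a * vsval u).
have gE a u : vsval (g a u) = a * vsval u by rewrite vsprojK // Ml ?subvsP.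
have gl a : linear (g a).
  by move=> k u v; rewrite /g linearP mulrDr -scalerAr linearP.
pose G (a : A) : 'End(subvs_of M) := sval (cid (lin_hom (gl a))).
have GE a u : G a u = g a u by rewrite /G; case: cid => h /= ->.
have Gl : linear G.
  move=> k a b; apply/lfunP => u; rewrite add_lfunE scale_lfunE !GE.
  by rewrite /g mulrDl -scalerAl linearP.
pose GL : {linear A -> 'End(subvs_of M)} :=
  HB.pack G (GRing.isLinear.Build R[i] A 'End(subvs_of M) _ G Gl).
have G1 : GL 1 = \1%VF.
  by apply/lfunP => u; rewrite GE id_lfunE; apply: subvs_inj; rewrite gE mul1r.
have GM x y : GL (x * y) = (GL x \o GL y)%VF.
  apply/lfunP => u; rewrite comp_lfunE !GE; apply: subvs_inj.
  by rewrite !gE mulrA.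
exists (KacRepr G1 GM), (linfun vsval); last first.
  by move=> a v; rewrite !lfunE /= GE gE.
split.
  by apply/eqP/lker0P => u v; rewrite !lfunE => /val_inj.
apply/vspaceP => m; apply/memv_imgP/idP => [[u _ ->] | Mm].
  by rewrite lfunE subvsP.
by exists (vsproj M m); rewrite ?memvf // lfunE /= vsprojK.
Qed.

(** Take a left ideal [M] of least dimension with [z * M] nonzero. If [N] is a
    submodule of [M] with right identity [e], then [M] is the sum of [N] and
    [M * (1 - e)], so [z] does not kill both; minimality leaves only the trivial
    choices of [N]. *)
Lemma exists_irreducible z : z != 0 ->
  exists2 V, irreducible_repr V & repr_act V z != 0.
Proof.
move=> z0; pose P M := (forall a m, m \in M -> a * m \in M) /\
  exists2 m, m \in M & z * m != 0.
have PT : P {:A}%VS by split=> [a m _|]; [|exists 1]; rewrite ?memvf ?mulr1.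
have [M [Ml [m Mm zm0]] minM] := min_dimv_ex PT.
have [V [f [kerf imf] fE]] := left_ideal_repr Ml; have /eqP/lker0P fI := kerf.
have [v _ mE] : exists2 v, v \in fullv & m = f v.
  by apply/memv_imgP; rewrite imf.
exists V; last first.
  by apply: contra_neq zm0 => zV; rewrite mE -fE zV zero_lfunE linear0.
split=> [V0 | U UV].
  have : v \in fullv by apply: memvf.
  by rewrite V0 memv0 => /eqP v0; move: zm0; rewrite mE v0 linear0 mulr0 eqxx.
have [-> | U0] := eqVneq U 0%VS; [by left | right].
pose N := (f @: U)%VS.
have sNM : (N <= M)%VS by rewrite -imf limgS ?subvf.
have Nl a n : n \in N -> a * n \in N.
  move=> /memv_imgP[u Uu ->]; rewrite -fE memv_img //.
  by apply: (subvP (UV a)); apply: memv_img.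
have [e Ne eid] := left_ideal_right_identity (star_subalgebraT A) (subvf N)
  (fun b x _ => Nl b x).
have PN : P N.
  split=> //; apply: contrapT => zN0.
  have zN n : n \in N -> z * n = 0.
    by move=> Nn; apply/eqP; apply: contrapT => /negP zn; apply: zN0; exists n.
  pose M' := (amulr (1 - e) @: M)%VS.
  have M'E a : a \in M -> a * (1 - e) \in M'.
    by move=> Ma; apply/memv_imgP; exists a; rewrite ?lfunE.
  have PM' : P M'.
    split=> [a _ /memv_imgP[b Mb ->]|].
      by rewrite lfunE /= mulrA M'E ?Ml.
    exists (m * (1 - e)); first exact: M'E.
    by rewrite mulrBr mulr1 mulrBr (zN (m * e)) ?subr0 // Nl.
  have := minM M' PM'; rewrite leqNgt => /negP; apply.
  rewrite -[X in (_ < X)%N](limg_ker_dim (amulr (1 - e)) M).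
  rewrite -[X in (X < _)%N]add0n ltn_add2r lt0n dimv_eq0.
  apply: contraNneq U0 => ker0.
  have N0 : N = 0%VS.
    apply/eqP; rewrite -subv0 -ker0; apply/subvP => n Nn.
    rewrite memv_cap (subvP sNM) //= memv_ker lfunE /=.
    by rewrite mulrBr mulr1 eid ?subrr.
  apply/eqP/vspaceP => u; rewrite memv0.
  apply/idP/eqP => [Uu|->]; last exact: mem0v.
  by apply: fI; apply/eqP; rewrite linear0 -memv0 -N0 memv_img.
have /eqP NM : N == M by rewrite eqEdim sNM minM.
apply/vspaceP => u; rewrite memvf.
have : f u \in N by rewrite NM -imf memv_img ?memvf.
by move=> /memv_imgP[u' Uu' /fI ->].
Qed.

End Separation.

(** * The central projection of a bi-ideal *)

Section GroupLikeProjection.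
Variables (R : realType) (A : kacAlgebra R).
Implicit Types (x y : A).
Local Notation "\eps x" := (counit A x : R[i]) (at level 10, x at level 8).
Local Notation S := (antipode A).

(** The canonical map [a (x) y |-> a_(1) (x) a_(2) y], whose inverse is
    [a (x) y |-> a_(1) (x) S(a_(2)) y]. *)
Definition shear : 'End(tensor A A) :=
  tlift (fun a y : A => sweedler (fun c d => c \ox (d * y)) a).

Lemma shear_tens a y : shear (a \ox y) = sweedler (fun c d => c \ox (d * y)) a.
Proof.
apply: tlift_tens; split=> [v k u1 u2 | u k v1 v2]; first exact: sweedlerP.
by rewrite -tliftP; apply: eq_tlift => c d; rewrite mulrDr -scalerAr tensPr.
Qed.

Lemma shear_inj : lker shear == 0%VS.
Proof.
pose T' : 'End(tensor A A) :=
  tlift (fun a y : A => sweedler (fun c d => c \ox (S d * y)) a).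
have T'E a y : T' (a \ox y) = sweedler (fun c d => c \ox (S d * y)) a.
  apply: tlift_tens; split=> [v k u1 u2 | u k v1 v2]; first exact: sweedlerP.
  by rewrite -tliftP; apply: eq_tlift => c d; rewrite mulrDr -scalerAr tensPr.
suff T'K : cancel shear T' by apply/lker0P; apply: can_inj T'K.
clearbody T'; move=> t; rewrite -[RHS]id_lfunE.
apply: tens_comp_ext => a y; rewrite [RHS]id_lfunE shear_tens tlift_comp.
transitivity (sweedler (fun b u =>
    sweedler (fun c d => b \ox (S c * (d * y))) u) a).
  rewrite sweedlerA; last split=> [b c k u v|b c k u v|b c k u v].
  - by apply: eq_tlift => b d; rewrite T'E.
  - by rewrite tensPl.
  - by rewrite linearP mulrDl -scalerAl tensPr.
  - by rewrite mulrDl -scalerAl mulrDr -scalerAr tensPr.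
transitivity (sweedler (fun b u => b \ox (\eps u *: y)) a).
  apply: eq_tlift => b u.
  have [|h hE] := @lin_hom _ A (tensor A A) (fun s => b \ox (s * y)).
    by move=> k v w; rewrite mulrDl -scalerAl tensPr.
  transitivity (h (tlift (fun c d => S c * d) (Delta A u))).
    by rewrite tlift_comp; apply: eq_tlift => c d; rewrite hE mulrA.
  by rewrite antipodel hE -scalerAl mul1r.
have [|h hE] := @lin_hom _ A (tensor A A) (fun s => s \ox y).
  by move=> k v w; rewrite tensPl.
rewrite -[RHS]hE -[in RHS](counitr a) tlift_comp; apply: eq_tlift => b u.
by rewrite linearZ /= hE tensZr.
Qed.

Section IdealProjection.
Variables (I : {vspace A}) (p : A).
Hypotheses (Il : forall a x, x \in I -> a * x \in I).
Hypotheses (Iq : 1 - p \in I) (Ip : forall x, x \in I -> x * p = 0).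
Hypothesis pC : forall a, a * p = p * a.
Hypothesis Ibi : forall x, x \in I ->
  sweedler (fun a b => (a * p) \ox (b * p)) x = 0.

Let pp : p * p = p.
Proof. by apply/esym/eqP; rewrite -subr_eq0 -[X in X - _]mul1r -mulrBl Ip. Qed.

Lemma ideal_slice_absorb x y : x \in I ->
  sweedler (fun c d => (c * (1 - p)) \ox (d * (y * p))) x =
  sweedler (fun c d => c \ox (d * (y * p))) x.
Proof.
move=> Ix; have z0 : sweedler (fun c d => (c * p) \ox (d * (y * p))) x = 0.
  transitivity (tmap \1%VF (amulr y)
      (sweedler (fun a b => (a * p) \ox (b * p)) x)); last first.
    by rewrite Ibi // linear0.
  rewrite tlift_comp; apply: eq_tlift => c d.
  rewrite tmap_tens id_lfunE [amulr _ _]lfunE /=.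
  by rewrite -mulrA -pC.
transitivity ((-1) *: sweedler (fun c d => (c * p) \ox (d * (y * p))) x +
   sweedler (fun c d => c \ox (d * (y * p))) x).
  2: by rewrite z0 scaler0 add0r.
rewrite -tliftP; apply: eq_tlift => c d.
by rewrite -tensPl scaleN1r mulrBr mulr1 addrC.
Qed.

(** The bi-ideal hypothesis is symmetric in the two legs and amounts to
    [Delta(p) (p (x) p) = p (x) p]. Finiteness gives more, just as a nonempty
    finite set of group elements closed under products is a subgroup. Let
    [e = 1 - p]. The shear map is injective and maps the ideal generated by
    [e (x) p] to itself, hence onto it. Left multiplication by
    [u = Delta(e) (1 (x) p)] fixes the values of the shear map on that ideal, so
    [e (x) p = u (e (x) p)], and this is [u] because [u] is in that ideal. *)
Lemma ideal_projection_grouplike :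
  sweedler (fun c d => c \ox (d * p)) p = p \ox p.
Proof.
pose e := 1 - p; have ep0 : e * p = 0 by apply: Ip.
have ee : e * e = e by rewrite {2}/e mulrBr mulr1 ep0 subr0.
have eC a : a * e = e * a by rewrite mulrBr mulrBl mulr1 mul1r pC.
pose Q := tmap (amulr e) (amulr p).
have QE a y : Q (a \ox y) = (a * e) \ox (y * p).
  by rewrite tmap_tens ![amulr _ _]lfunE.
clearbody Q.
have [F FE] : exists F : 'End(tensor A A), forall t, F t = shear (Q t).
  by exists (shear \o Q)%VF => t; rewrite comp_lfunE.
have FtE a y :
    F (a \ox y) = sweedler (fun c d => c \ox (d * (y * p))) (a * e).
  by rewrite FE QE shear_tens.
have QF t : Q (F t) = F t.
  apply: tens_comp_ext => a y; rewrite FtE tlift_comp.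
  rewrite -[RHS]ideal_slice_absorb ?Il //; apply: eq_tlift => c d.
  by rewrite QE -/e -!mulrA pp.
have imF : (shear @: limg Q = limg Q)%VS.
  apply/eqP; rewrite eqEdim limg_dim_eq ?leqnn ?andbT; last first.
    by apply/eqP; rewrite -subv0 -(eqP shear_inj) capvSr.
  apply/subvP => _ /memv_imgP[_ /memv_imgP[t _ ->] ->].
  by rewrite -FE -QF memv_img ?memvf.
have [t0 t0E] : exists t, e \ox p = F t.
  have : e \ox p \in limg Q.
    by rewrite -[X in X \ox _]ee -[X in _ \ox X]pp -QE memv_img ?memvf.
  rewrite -imF => /memv_imgP[_ /memv_imgP[t _ ->] ->].
  by exists t; rewrite FE.
pose u := sweedler (fun c d => c \ox (d * p)) e.
have uF t : tmul u (F t) = F t.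
  have [_ tr] := tmul_bilin A; have [h hE] := lin_hom (tr u).
  rewrite -hE; apply: tens_comp_ext => a y; rewrite hE FtE tmul_sweedler.
  have eae : a * e = e * (a * e) by rewrite -[RHS]eC -mulrA ee.
  rewrite [in RHS]eae [RHS]sweedlerM; last first.
    split=> [v k u1 u2 | v k u1 u2]; rewrite ?tensPl //.
    by rewrite mulrDl -scalerAl tensPr.
  apply: eq_tlift => c d; apply: eq_tlift => c' d'; rewrite tmul_tens.
  by congr (_ \ox _); rewrite -!mulrA; congr (_ * _); rewrite -pC -!mulrA pp.
have ue : tmul u (e \ox p) = u.
  have [tl _] := tmul_bilin A; have [h hE] := lin_hom (tl (e \ox p)).
  rewrite -hE tlift_comp -[RHS]/(sweedler _ _).
  have uE : u = sweedler (fun c d => c \ox (d * (1 * p))) e.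
    by apply: eq_tlift => c d; rewrite mul1r.
  rewrite [RHS]uE -[RHS]ideal_slice_absorb //; apply: eq_tlift => c d.
  by rewrite hE tmul_tens -mulrA pp mul1r.
have uE : u = e \ox p by rewrite -ue t0E uF.
rewrite -[X in sweedler _ X](subKr 1 p) -/e.
have -> : 1 - e = (-1) *: e + 1 by rewrite scaleN1r addrC.
rewrite sweedlerP -/u uE /sweedler Delta1 tlift_tens; last first.
  split=> [v k u1 u2 | v k u1 u2]; rewrite ?tensPl //.
  by rewrite mulrDl -scalerAl tensPr.
by rewrite mul1r -tensPl scaleN1r addrC subKr.
Qed.

End IdealProjection.

End GroupLikeProjection.

(** * Coinvariants of a central projection *)

Section Coinvariants.
Variables (R : realType) (A : kacAlgebra R).
Implicit Types (x y : A).
Local Notation "\eps x" := (counit A x : R[i]) (at level 10, x at level 8).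

Lemma tstarP k (s t : tensor A A) :
  tstar (@star R A) (k *: s + t) =
  k^* *: tstar (@star R A) s + tstar (@star R A) t.
Proof.
rewrite /tstar scaler_sumr -big_split; apply: eq_bigr => i _.
rewrite scaler_sumr -big_split; apply: eq_bigr => j _ /=.
by rewrite !mxE rmorphD rmorphM scalerDl scalerA.
Qed.

(** When [A p] is the quotient of [A] by a Hopf ideal, these are the
    coinvariants of [A] for the coaction of that quotient. *)
Definition coinvariant (p x : A) : Prop :=
  sweedler (fun a b => a \ox (b * p)) x = x \ox p.

Section CentralProjection.
Variable p : A.
Hypotheses (ps : star p = p) (pC : forall a, a * p = p * a).

Lemma coinvariantM x y :
  coinvariant p x -> coinvariant p y -> coinvariant p (x * y).
Proof.
move=> xp yp; rewrite /coinvariant sweedlerM; last first.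
  split=> [v k u1 u2 | v k u1 u2]; rewrite ?tensPl //.
  by rewrite mulrDl -scalerAl tensPr.
transitivity (sweedler (fun a b => (a * y) \ox (b * p)) x).
  apply: eq_tlift => a b.
  transitivity (tlift (fun c d => (a * c) \ox (b * d))
     (sweedler (fun c d => c \ox (d * p)) y)).
    rewrite tlift_comp; apply: eq_tlift => c d; rewrite tlift_tens ?mulrA //.
    split=> [v k u1 u2 | v k u1 u2];
      by rewrite mulrDr -scalerAr ?tensPl ?tensPr.
  rewrite yp tlift_tens //.
  by split=> [v k u1 u2 | v k u1 u2]; rewrite mulrDr -scalerAr ?tensPl ?tensPr.
have bl : bilin (fun a d : A => (a * y) \ox d).
  split=> [v k u1 u2 | v k u1 u2]; rewrite ?tensPr //.
  by rewrite mulrDl -scalerAl tensPl.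
transitivity (tlift (fun a d => (a * y) \ox d)
   (sweedler (fun c d => c \ox (d * p)) x)).
  by rewrite tlift_comp; apply: eq_tlift => c d; rewrite tlift_tens.
by rewrite xp tlift_tens.
Qed.

Lemma coinvariant_star x : coinvariant p x -> coinvariant p (star x).
Proof.
rewrite /coinvariant /sweedler Delta_star => xp.
have stE := tstar_tens (@starP R A).
rewrite -ps -stE -xp ps; set t := Delta A x.
have [h hE] : exists h : 'End(tensor A A),
    forall a b : A, h (a \ox b) = a \ox (b * p).
  exists (tmap \1%VF (amulr p)) => a b.
  by rewrite tmap_tens id_lfunE [amulr _ _]lfunE.
have hE' s : tlift (fun a b => a \ox (b * p)) s = h s.
  by rewrite -{2}[s]tlift_tensE tlift_comp; apply: eq_tlift => a b; rewrite hE.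
rewrite !hE'; clearbody t.
have stD u v :
    tstar (@star R A) (u + v) = tstar (@star R A) u + tstar (@star R A) v.
  by have := tstarP 1 u v; rewrite rmorph1 !scale1r.
have st0 : tstar (@star R A) 0 = 0.
  by apply: (addrI (tstar (@star R A) 0)); rewrite -stD !addr0.
have stZ k s : tstar (@star R A) (k *: s) = k^* *: tstar (@star R A) s.
  by rewrite -[k *: s]addr0 tstarP st0 addr0.
rewrite [in RHS](tens_sum t) [in LHS]/tstar !linear_sum (big_morph _ stD st0).
apply: eq_bigr => i _; rewrite !linear_sum (big_morph _ stD st0).
apply: eq_bigr => j _; rewrite linearZ /= hE [in RHS]linearZ /= hE stZ stE.
by rewrite starM ps pC.
Qed.

Lemma coinvariant_lcoideal : exists2 B, left_coideal_subalgebra B &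
  forall x, x \in B <-> coinvariant p x.
Proof.
have [|k u v uP vP|B BE] := @vspace_of_pred _ A (coinvariant p).
- rewrite /coinvariant /sweedler !linear0.
  by have := tensZl 0 (0 : A) p; rewrite !scale0r => ->.
- by rewrite /coinvariant sweedlerP uP vP tensPl.
exists B => //; split; first split.
- apply/BE; rewrite /coinvariant /sweedler Delta1 tlift_tens ?mul1r //.
  split=> [v k u1 u2 | v k u1 u2]; rewrite ?tensPl //.
  by rewrite mulrDl -scalerAl tensPr.
- by move=> x y /BE xp /BE yp; apply/BE/coinvariantM.
- by move=> x /BE xp; apply/BE/coinvariant_star.
move=> x /BE xp; apply/mem_tens_vsr => i; apply/BE.
have [|d dE] := @lin_hom _ A R[i]^o (coord (vbasis {:A}) i).
  exact: linearP.
rewrite /coinvariant.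
have -> : tlift (fun u v => coord (vbasis {:A}) i u *: v) (Delta A x) =
    sweedler (fun u v => (d u : R[i]) *: v) x.
  by apply: eq_tlift => u v; rewrite dE.
transitivity (sweedler (fun u v =>
   sweedler (fun a b => (d u : R[i]) *: (a \ox (b * p))) v) x).
  rewrite /sweedler [in LHS]tlift_comp tlift_comp; apply: eq_tlift => u v.
  by rewrite tliftZ linearZ linearZ.
rewrite sweedlerA; last split=> [b c k u v|b c k u v|b c k u v].
- have bl : bilin (fun w b : A =>
      sweedler (fun u a => (d u : R[i]) *: (a \ox b)) w).
    split=> [v k u1 u2 | w k v1 v2]; first exact: sweedlerP.
    rewrite -tliftP; apply: eq_tlift => u a.
    by rewrite tensPr scalerDr !scalerA mulrC.
  transitivity (tlift
     (fun w b => sweedler (fun u a => (d u : R[i]) *: (a \ox b)) w)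
     (sweedler (fun c d => c \ox (d * p)) x)).
    by rewrite tlift_comp; apply: eq_tlift => c e; rewrite tlift_tens.
  rewrite xp tlift_tens //.
  have [h hE] := lin_hom ((tens_bilin A A).1 p).
  by rewrite -hE tlift_comp; apply: eq_tlift => u v; rewrite linearZ /= hE.
- by rewrite dualP scalerDl -scalerA.
- by rewrite tensPl scalerDr !scalerA mulrC.
- by rewrite mulrDl -scalerAl tensPr scalerDr !scalerA mulrC.
Qed.

End CentralProjection.

(** Apply the counit to the first leg of the coinvariance equation. *)
Lemma coinvariant_mul p x : coinvariant p x -> x * p = \eps x *: p.
Proof.
move=> xp; have bl : bilin (fun a b : A => (counit A a : R[i]) *: b).
  split=> [v k u1 u2 | v k u1 u2]; last by rewrite scalerDr !scalerA mulrC.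
  by rewrite counitP scalerDl -scalerA.
have := congr1 (tlift (fun a b : A => (counit A a : R[i]) *: b)) xp.
rewrite tlift_comp tlift_tens // => <-.
have [|h hE] := @lin_hom _ A A (fun y => y * p).
  by move=> k u v; rewrite mulrDl -scalerAl.
rewrite -hE -{1}(counitl x) tlift_comp; apply: eq_tlift => a b.
by rewrite tlift_tens // linearZ /= hE.
Qed.

End Coinvariants.

(** * The common annihilator of the tensor powers *)

Section Faithful.
Variables (R : realType) (A : kacAlgebra R).
Implicit Types (x y : A) (V W : kac_repr A) (I : {vspace A}).

Lemma linear_act V v : linear (fun a => repr_act V a v).
Proof. by move=> k a b; rewrite linearP add_lfunE scale_lfunE. Qed.

Lemma tensor_reprE V W x (v : repr_space V) (w : repr_space W) :
  repr_act (tensor_repr V W) x (v \ox w) =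
  sweedler (fun a b => repr_act V a v \ox repr_act W b w) x.
Proof.
pose g (f : 'End(tensor (repr_space V) (repr_space W))) := f (v \ox w).
have gl : linear g by move=> k f f'; rewrite /g add_lfunE scale_lfunE.
rewrite -[LHS]/(g (tlift _ _)) (linear_tlift _ _ gl).
by apply: eq_tlift => a b; rewrite /g tmap_tens.
Qed.

(** Modulo [I], the second leg of the coproduct of an element of [I] acts as
    zero on [W]; with [I] the annihilator of a family of representations, this
    means that [I] kills the tensor products of the family with [W]. *)
Definition slice_closed I W := forall x, x \in I ->
  forall (d : 'Hom(repr_space W, R[i]^o)) (w : repr_space W),
    sweedler (fun a b => (d (repr_act W b w) : R[i]) *: a) x \in I.

Lemma dual_linear W (d : 'Hom(repr_space W, R[i]^o)) k u v :
  d (k *: u + v) = k * (d u : R[i]) + (d v : R[i]).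
Proof. by rewrite linearP. Qed.

(** By coassociativity, a slice along the tensor product is obtained by slicing
    along [W] first and along [V] next. *)
Lemma slice_closed_tensor I V W :
  slice_closed I V -> slice_closed I W -> slice_closed I (tensor_repr V W).
Proof.
move=> IV IW x Ix d w.
have [|h hE] := @lin_hom _ (repr_space (tensor_repr V W)) A (fun w =>
    sweedler (fun a b => (d (repr_act (tensor_repr V W) b w) : R[i]) *: a) x).
  move=> k u v; rewrite -tliftP; apply: eq_tlift => a b.
  by rewrite linearP dual_linear scalerDl scalerA.
rewrite -hE; apply: tens_vs_ind (tens_vsT w) => {}v {}w _ _; rewrite hE.
pose F j u := sweedler (fun a c =>
  (d (repr_act V c v \ox (vbasis {:repr_space W})`_j) : R[i]) *: a) u.
have -> : sweedler (fun a b =>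
    (d (repr_act (tensor_repr V W) b (v \ox w)) : R[i]) *: a) x =
  \sum_(j < \dim {:repr_space W}) F j (sweedler (fun u e =>
    coord (vbasis {:repr_space W}) j (repr_act W e w) *: u) x).
  transitivity (sweedler (fun a b => sweedler (fun c e =>
     (d (repr_act V c v \ox repr_act W e w) : R[i]) *: a) b) x).
    apply: eq_tlift => a b; rewrite tensor_reprE tlift_comp.
    have [|g gE] := @lin_hom _ R[i]^o A (fun k : R[i] => k *: a).
      by move=> k u v'; rewrite scalerDl scalerA.
    by rewrite -[LHS]gE tlift_comp; apply: eq_tlift => c e; rewrite gE.
  rewrite sweedlerA; last first.
    split=> [b c k u v'|b c k u v'|b c k u v'].
    - by rewrite scalerDr !scalerA mulrC.
    - by rewrite linear_act tensPl dual_linear scalerDl scalerA.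
    - by rewrite linear_act tensPr dual_linear scalerDl scalerA.
  transitivity (sweedler (fun u e => \sum_(j < \dim {:repr_space W})
     coord (vbasis {:repr_space W}) j (repr_act W e w) *: F j u) x).
    apply: eq_tlift => u e.
    rewrite {1}(coord_vbasis (memvf (repr_act W e w))).
    rewrite /F; under [RHS]eq_bigr do rewrite -tliftZ.
    rewrite -tlift_sum; apply: eq_tlift => c b.
    have [|g gE] := @lin_hom _ (repr_space W) R[i]^o
        (fun w => d (repr_act V b v \ox w)).
      by move=> k u' v'; rewrite tensPr linearP.
    rewrite -gE linear_sum scaler_suml; apply: eq_bigr => j _.
    by rewrite linearZ /= gE -scalerA.
  rewrite [LHS]tlift_sum; apply: eq_bigr => j _.
  have [|g gE] := @lin_hom _ A A (F j); first exact: sweedlerP.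
  by rewrite -gE tlift_comp; apply: eq_tlift => u e; rewrite linearZ /= gE.
apply: memv_suml => j _.
have [|c cE] := @lin_hom _ (repr_space W) R[i]^o
  (coord (vbasis {:repr_space W}) j).
  exact: linearP.
have [|d' d'E] := @lin_hom _ (repr_space V) R[i]^o
  (fun v => d (v \ox (vbasis {:repr_space W})`_j)).
  by move=> k u u'; rewrite tensPl linearP.
have := IV _ (IW _ Ix c w) d' v; congr (_ \in I).
rewrite /F; congr (tlift _ (Delta A _)).
  by apply/funext => a; apply/funext => b; rewrite d'E.
by apply: eq_tlift => a b; rewrite cE.
Qed.

Section Annihilator.
Variables (V : kac_repr A) (I : {vspace A}).
Hypothesis IE : forall x,
  x \in I <-> forall n, repr_act (tensor_pow V n.+1) x = 0.

Lemma annihilatorMl a x : x \in I -> a * x \in I.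
Proof. by move/IE => x0; apply/IE => n; rewrite repr_actM x0 comp_lfun0r. Qed.

Lemma annihilatorMr a x : x \in I -> x * a \in I.
Proof. by move/IE => x0; apply/IE => n; rewrite repr_actM x0 comp_lfun0l. Qed.

Lemma annihilator_slice1 : slice_closed I V.
Proof.
move=> x Ix d v; apply/IE => n; apply/lfunP => u; rewrite zero_lfunE.
have := (IE x).1 Ix n.+1.
move=> /(congr1 (fun f : 'End(_) => f (u \ox v))).
rewrite -[tensor_pow V n.+2]/(tensor_repr (tensor_pow V n.+1) V).
rewrite tensor_reprE zero_lfunE => x0.
have [h hE] := lin_hom (@linear_act (tensor_pow V n.+1) u).
have bl : bilin (fun u v =>
    (d v : R[i]) *: u :> repr_space (tensor_pow V n.+1)).
  split=> [v' k u1 u2 | u' k v1 v2].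
  2: by rewrite dual_linear scalerDl scalerA.
  by rewrite scalerDr !scalerA mulrC.
transitivity (tlift
    (fun u v => (d v : R[i]) *: u :> repr_space (tensor_pow V n.+1))
    (sweedler
      (fun a b => repr_act (tensor_pow V n.+1) a u \ox repr_act V b v) x)).
  rewrite -hE !tlift_comp; apply: eq_tlift => a b.
  by rewrite tlift_tens // linearZ /= hE.
by rewrite x0 linear0.
Qed.

Lemma annihilator_slice n : slice_closed I (tensor_pow V n.+1).
Proof.
elim: n => [|n IHn]; first exact: annihilator_slice1.
exact: slice_closed_tensor IHn annihilator_slice1.
Qed.

(** The left-hand side is detected by functionals [d] on its first leg, and the
    slice [d(x_(1) p) x_(2)] is in [I] because [d(_ p)] vanishes on the slices
    of [x] along the tensor powers. *)
Lemma annihilator_biideal p x : (forall y, y \in I -> y * p = 0) -> x \in I ->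
  sweedler (fun a b => (a * p) \ox (b * p)) x = 0.
Proof.
move=> Ip Ix; apply: slices_eq0 => d.
have bl : bilin (fun u v : A => (d u : R[i]) *: v).
  split=> [v' k u1 u2 | u' k v1 v2]; first by rewrite dualP scalerDl scalerA.
  by rewrite scalerDr !scalerA mulrC.
pose y := sweedler (fun a b => (d (a * p) : R[i]) *: b) x.
suff Iy : y \in I.
  have [|h hE] := @lin_hom _ A A (fun a => a * p).
    by move=> k u v; rewrite mulrDl -scalerAl.
  rewrite -[RHS](Ip y Iy) -hE !tlift_comp; apply: eq_tlift => a b.
  by rewrite tlift_tens // linearZ /= hE.
apply/IE => n; apply/lfunP => v; rewrite zero_lfunE.
apply/eqP; apply: contrapT => /negP /exists_dual[c].
suff -> : c (repr_act (tensor_pow V n.+1) y v) = 0.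
  by move/eqP; rewrite eq_sym oner_eq0.
have [h hE] := lin_hom (@linear_act (tensor_pow V n.+1) v).
have [|g gE] := @lin_hom _ A R[i]^o (fun a => d (a * p)).
  by move=> k u u'; rewrite mulrDl -scalerAl linearP.
have y0 := Ip _ (annihilator_slice Ix c v).
transitivity (g (sweedler (fun a b =>
    (c (repr_act (tensor_pow V n.+1) b v) : R[i]) *: a) x)); last first.
  by rewrite gE y0 linear0.
rewrite -hE !tlift_comp; apply: eq_tlift => a b.
by rewrite [h _]linearZ !linearZ /= gE hE [LHS]mulrC.
Qed.

(** The coinvariants of the complementary projection [p] of [I] form a left
    coideal subalgebra which acts trivially on [V] and contains [p]. Since [V]
    detects all left coideal subalgebras, [p] is a scalar, so [I] is zero. *)
Lemma separated_faithful z : separates {:A} z -> repr_act V z != 0 -> I = 0%VS.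
Proof.
move=> zsep z0.
have [p [Iq Ip ps pC]] := ideal_projection annihilatorMl annihilatorMr.
have pp := ideal_projection_grouplike annihilatorMl Iq Ip pC
  (fun x => @annihilator_biideal p x Ip).
have [B lcB BE] := coinvariant_lcoideal ps pC.
have p1 : repr_act V p = \1%VF.
  have := (IE _).1 Iq 0%N; rewrite linearB /= repr_act1 => /eqP.
  by rewrite subr_eq0 => /eqP.
pose L : lcoideal A := Sub B (asboolT lcB).
have [sB|nB] := boolP (val L <= <[1]>)%VS; last first.
  case/negP: z0; apply/eqP; apply: zsep nB _ _; first exact: subvf.
  move=> b Bb; rewrite -[LHS]comp_lfun1r -p1 -repr_actM.
  by rewrite (coinvariant_mul ((BE b).1 Bb)) linearZ.
have /vlineP[k pE] : p \in <[1]>%VS by apply: (subvP sB); apply/BE.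
have [k1|k1] := eqVneq k 1.
  apply/vspaceP => x; rewrite memv0.
  apply/idP/eqP => [Ix|->]; last exact: mem0v.
  by rewrite -(Ip x Ix) pE k1 scale1r mulr1.
have I1 : 1 \in I.
  move: Iq; rewrite pE -{1}[1]scale1r -scalerBl => /(memvZ (1 - k)^-1).
  by rewrite scalerA mulVf ?scale1r // subr_eq0 eq_sym.
have := annihilatorMl z I1; rewrite mulr1 => /IE/(_ 0%N) zz.
by rewrite zz eqxx in z0.
Qed.

End Annihilator.

(** For a nonzero [w] in [W], the module [W] is isomorphic to [A * (1 - e)],
    with [e] the right identity of the annihilator of [w]. If [1 - e] does not
    kill the vector [v] of a tensor power, then [a w |-> a (1 - e) v] is a
    nonzero intertwiner, hence injective since [W] is irreducible. *)
Lemma faithful_embedding V W :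
    (forall x, (forall n, repr_act (tensor_pow V n.+1) x = 0) -> x = 0) ->
  irreducible_repr W -> exists2 n, (0 < n)%N & subrepr W (tensor_pow V n).
Proof.
move=> faith [W0 Wirr].
have [w w0] : exists w : repr_space W, w != 0.
  by exists (vpick {:repr_space W}); rewrite vpick0; apply/eqP.
have [phi phiE] := lin_hom (@linear_act W w).
have phi1 : phi 1 = w by rewrite phiE repr_act1 id_lfunE.
have phiM x a : phi (x * a) = repr_act W x (phi a).
  by rewrite !phiE repr_actM comp_lfunE.
have phiT : limg phi = fullv.
  have [x|phi0|//] := Wirr (limg phi).
    apply/subvP => _ /memv_imgP[_ /memv_imgP[a _ ->] ->].
    by rewrite -phiM memv_img ?memvf.
  have : w \in limg phi by rewrite -phi1 memv_img ?memvf.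
  by rewrite phi0 memv0 (negPf w0).
have [|e Ne eid] :=
  left_ideal_right_identity (star_subalgebraT A) (subvf (lker phi)).
  by move=> b x _; rewrite !memv_ker phiM => /eqP->; rewrite linear0.
have q0 : 1 - e != 0.
  apply: contraNneq w0 => /eqP; rewrite subr_eq0 => /eqP e1.
  by rewrite -phi1 e1 -memv_ker.
have [n [v v0]] : exists n v, repr_act (tensor_pow V n.+1) (1 - e) v != 0.
  apply: contrapT => no; case/eqP: q0; apply: faith => n; apply/lfunP => v.
  rewrite zero_lfunE; apply/eqP; apply: contrapT => /negP nz; apply: no.
  by exists n, v.
set U := tensor_pow V n.+1 in v v0 *.
have [psi psiE] := lin_hom (@linear_act U (repr_act U (1 - e) v)).
have psiM x a : psi (x * a) = repr_act U x (psi a).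
  by rewrite !psiE repr_actM comp_lfunE.
pose f := (psi \o phi^-1)%VF.
have fE a : f (phi a) = psi a.
  rewrite comp_lfunE; set b' := (phi^-1)%VF _; pose b := b' - a.
  rewrite -(subrK a b') linearD /= -/b; suff -> : psi b = 0 by rewrite add0r.
  have : b \in lker phi.
    by rewrite memv_ker linearB /= limg_lfunVK ?subrr // phiT memvf.
  move/eid => bE; rewrite psiE -comp_lfunE -repr_actM mulrBr mulr1 bE subrr.
  by rewrite linear0 zero_lfunE.
have onto u : exists a, u = phi a.
  have : u \in limg phi by rewrite phiT memvf.
  by case/memv_imgP=> a _ ->; exists a.
exists n.+1 => //; exists f; last first.
  move=> x; apply/lfunP => u; have [a ->] := onto u.
  by rewrite !comp_lfunE -phiM -!(comp_lfunE psi) !fE psiM.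
have [x|//|kerT] := Wirr (lker f).
  apply/subvP => _ /memv_imgP[u fu ->]; move: fu; have [a ->] := onto u.
  by rewrite !memv_ker -phiM !fE psiM => /eqP->; rewrite linear0.
have : w \in lker f by rewrite kerT memvf.
rewrite -phi1 memv_ker fE psiE repr_act1 id_lfunE.
by rewrite (negPf v0).
Qed.

End Faithful.

Theorem corollary7p44 (R : realType) (A : kacAlgebra R) :
  cyclic_kac A -> linearly_primitive A.
Proof.
move=> /cyclic_separating[z z0 zsep].
have [V Virr zV] := exists_irreducible z0.
exists V => // W Wirr; apply: faithful_embedding Wirr => x x0.
have [||I IE] := @vspace_of_pred _ A
    (fun x => forall n, repr_act (tensor_pow V n.+1) x = 0).
- by move=> n; rewrite linear0.
- by move=> k u v u0 v0 n; rewrite linearP u0 v0 /= scaler0 addr0.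
have I0 := separated_faithful IE zsep zV.
by apply/eqP; rewrite -memv0 -I0; apply/IE.
Qed.
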